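(* Let $N$ be a positive integer and let $\theta\in\mathbb{C}$ satisfy $|\theta|=1$, $\operatorname{Re}\theta>0$, $\operatorname{Im}\theta>0$. Then for all $(x,n)\in\mathbb{R}\oplus\mathbb{Z}/N\mathbb{Z}$ $$D_\theta(x,n)\,D_\theta(-x,-n)=\langle x,n\rangle\, e^{-\pi i\left(N+2c_\theta^2N^{-1}\right)/6}.$$
   Context: Here $c_\theta=i(\theta+\theta^{-1})/2$, $\langle x,n\rangle=e^{\pi i x^2}e^{-\pi i n(n+N)/N}$, and $$D_\theta(x,n)=\prod_{j=0}^{N-1}\Phi_\theta\!\left(\frac{x}{\sqrt N}+(1-N^{-1})c_\theta-i\theta^{-1}\frac jN-i\theta\left\{\frac{j+n}{N}\right\}\right),$$ where $\{\cdot\}$ denotes the fractional part and $\Phi_\theta$ is Faddeev's quantum dilogarithm $$\Phi_\theta(z)=\frac{\left(e^{2\pi\theta(z+c_\theta)};e^{2\pi i\theta^2}\right)_\infty}{\left(e^{2\pi\theta^{-1}(z-c_\theta)};e^{-2\pi i\theta^{-2}}\right)_\infty},\qquad (x;q)_\infty=\prod_{j\ge0}(1-xq^j).$$ *)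

(* Defs.v *)
From Stdlib Require Export Reals ZArith.
From Coquelicot Require Export Coquelicot.
From Stdlib Require Import Lia Lra.

Open Scope C_scope.

Definition Cexp (z : C) : C :=
  ((exp (Re z) * cos (Im z))%R, (exp (Re z) * sin (Im z))%R).

Fixpoint Cprod (f : nat -> C) (n : nat) : C :=
  match n with
  | O => 1
  | S m => Cprod f m * f m
  end.

Lemma Cprod_ext (f g : nat -> C) (n : nat) :
  (forall j, f j = g j) -> Cprod f n = Cprod g n.
Proof.
intros H; induction n as [| n IH]; simpl; [reflexivity | now rewrite IH, H].
Qed.

(* Limit of [f] along the filter [F]; meaningful when the limit exists, see
   [Clim_unique]. *)
Definition Clim {T : Type} (f : T -> C) (F : (T -> Prop) -> Prop) : C :=
  C_complete_lim (filtermap f F).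

Lemma Clim_unique {T : Type} (f : T -> C) (F : (T -> Prop) -> Prop)
  (FF : ProperFilter F) (l : C) :
  filterlim f F (locally l) -> Clim f F = l.
Proof.
intros H.
assert (Hc : filterlim f F (locally (Clim f F))).
{ intros P [eps HP].
  assert (Hb : filtermap f F (ball (C_complete_lim (filtermap f F)) eps)).
  { apply C_complete_ax1.
    - now apply filtermap_proper_filter.
    - intros e; exists l; apply H; exists e; now intros y Hy. }
  revert Hb; unfold filtermap; apply filter_imp; intros t; apply HP. }
exact (@filterlim_locally_unique T C_AbsRing C_NormedModule F
         (Proper_StrongProper F FF) f _ _ Hc H).
Qed.

Definition qpoch (x q : C) : C :=
  Clim (Cprod (fun j => 1 - x * q ^ j)) eventually.

Definition c_ (theta : C) : C := Ci * (theta + / theta) / 2.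

Definition faddeev_num (theta w : C) : C :=
  qpoch (Cexp (2 * PI * theta * (w + c_ theta)))
        (Cexp (2 * PI * Ci * theta ^ 2)).

Definition faddeev_den (theta w : C) : C :=
  qpoch (Cexp (2 * PI * / theta * (w - c_ theta)))
        (Cexp (- (2 * PI * Ci * / theta ^ 2))).

(* Value at [z] of the meromorphic function [faddeev_num / faddeev_den].  The
   limit over [w <> z] is needed because this quotient has removable
   singularities at which numerator and denominator both vanish, some of them
   on the real line (e.g. z = Im theta when |theta| = 1); there Coquelicot's
   total division would give 0.  Where the denominator does not vanish the
   limit is the plain quotient, by continuity. *)
Definition Phi (theta z : C) : C :=
  Clim (fun w => faddeev_num theta w / faddeev_den theta w) (locally' z).

(* An element of Z/NZ is given by an integer representative [n]; [bracket] and
   [D] do not depend on its choice, see [bracket_period] and [D_period]. *)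
Definition bracket (N : nat) (x : R) (n : Z) : C :=
  Cexp (PI * Ci * RtoC x ^ 2)
  * Cexp (- (PI * Ci * (IZR n * (IZR n + INR N)) / INR N)).

Definition D (N : nat) (theta : C) (x : R) (n : Z) : C :=
  Cprod (fun j =>
    Phi theta (x / sqrt (INR N) + (1 - / INR N) * c_ theta
               - Ci * / theta * (INR j / INR N)
               - Ci * theta * frac_part ((INR j + IZR n) / INR N))) N.

Lemma Cexp_sub_2PI (z : C) (k : Z) : Cexp (z - 2 * PI * Ci * IZR k) = Cexp z.
Proof.
destruct z as [a b]; unfold Cexp, Re, Im; simpl.
replace (a + _)%R with a by ring.
replace (b + _)%R with (b + 2 * IZR (- k) * PI)%R by (rewrite opp_IZR; ring).
set (t := (b + 2 * IZR (- k) * PI)%R).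
assert (H : cos t = cos b /\ sin t = sin b).
{ unfold t; destruct (Z_le_gt_dec 0 (- k)) as [Hk | Hk].
  - rewrite <- (Z2Nat.id _ Hk), <- INR_IZR_INZ.
    split; [apply cos_period | apply sin_period].
  - rewrite <- (cos_period _ (Z.to_nat k)), <- (sin_period _ (Z.to_nat k)).
    rewrite INR_IZR_INZ, Z2Nat.id, opp_IZR by lia.
    split; f_equal; ring. }
destruct H as [-> ->]; reflexivity.
Qed.

Lemma bracket_period (N : nat) (x : R) (n : Z) :
  (0 < N)%nat -> bracket N x (n + Z.of_nat N) = bracket N x n.
Proof.
intros HN; unfold bracket; f_equal.
rewrite <- (Cexp_sub_2PI (- (PI * Ci * (IZR n * (IZR n + INR N)) / INR N))
              (n + Z.of_nat N)).
f_equal.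
rewrite plus_IZR, <- INR_IZR_INZ, RtoC_plus.
field.
intros H; apply RtoC_inj in H; apply lt_0_INR in HN; lra.
Qed.

Lemma D_period (N : nat) (theta : C) (x : R) (n : Z) :
  (0 < N)%nat -> D N theta x (n + Z.of_nat N) = D N theta x n.
Proof.
intros HN; unfold D.
assert (HN' := lt_0_INR _ HN).
assert (Hf : forall j : nat, frac_part ((INR j + IZR (n + Z.of_nat N)) / INR N)
             = frac_part ((INR j + IZR n) / INR N)).
{ intros j; rewrite plus_IZR, <- INR_IZR_INZ.
  set (r := ((INR j + IZR n) / INR N)%R).
  replace (_ / _)%R with (r + 1)%R by (unfold r; field; lra).
  unfold frac_part.
  destruct (base_Int_part r) as [H1 H2].
  replace (Int_part (r + 1)) with (Int_part r + 1)%Z.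
  - rewrite plus_IZR; ring.
  - apply Int_part_spec; rewrite plus_IZR; lra. }
apply Cprod_ext; intros j; now rewrite Hf.
Qed.

(* Main.v *)
(* For |theta| = 1 put tau = theta^2.  The products num(w) num(-w) and
   e^(i pi w^2) den(w) den(-w), read in the variable v = -i theta w, are both
   theta functions for the lattice Z + tau Z with the same multipliers, and such
   functions form a line (finite Fourier analysis on the grids v + Z/M).  Their
   ratio is therefore a constant.  Evaluating at the half periods and using
   Euler's identity for prod (1 + q^j)(1 - q^(2j-1)) gives the cube of the
   constant, and continuity along the unit half-circle, with tau = i as base
   point, selects the root:
   Phi(z) Phi(-z) = e^(i pi z^2 + i pi (tau + 1/tau)/12).
   In D(x, n) D(-x, -n) the factor j of the first product has argument opposite
   to that of the factor N - 1 - j of the second, and summing the squares of the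
   arguments gives the right-hand side.  The arguments stay at height below
   Re theta, which is where the poles of Phi begin. *)
Require Import Defs.
From Stdlib Require Import Lia Lra Psatz Ranalysis5.

(** * The complex exponential *)

(** That theta functions with given multipliers form a line usually rests on Fourier coefficients
    and Cauchy's theorem. Here no integral occurs: holomorphy is replaced by [regular], an integral
    over a period by the mean over [M] equidistant points, and the shift of a contour by the
    estimate that such a mean changes by O(1/M) under a complex translation. All of this is
    quantitative, so the infinite products enter only through bounds uniform in the number of
    factors. Only the cube of the constant comes out of the half periods because their two relations
    contain squares of three theta constants for each nome; eliminating two of the three leaves the
    sixth power of one quotient, that is, the cube of its square. The point [Ci] is the base point
    because it is fixed by tau -> -1/tau, which makes the two nomes equal. Since [Phi] is a limit
    over punctured neighbourhoods, its inversion relation is first an identity between honest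
    fractions near the point and then passes to the limit. For the limit to exist, each zero of the
    denominator below the height of the poles must be matched by a zero of the numerator, both
    simple. *)

Lemma Cexp_plus (a b : C) : Cexp (a + b) = Cexp a * Cexp b.
Proof.
destruct a as [a1 a2], b as [b1 b2]; unfold Cexp, Cmult; simpl.
rewrite exp_plus, cos_plus, sin_plus; f_equal; ring.
Qed.

Lemma Cexp_0 : Cexp 0 = 1.
Proof.
unfold Cexp; simpl; rewrite exp_0, cos_0, sin_0.
apply injective_projections; simpl; ring.
Qed.

Lemma Cmod_Cexp (z : C) : Cmod (Cexp z) = exp (Re z).
Proof.
assert (H : (Cmod (Cexp z) ^ 2 = exp (Re z) ^ 2)%R).
{ rewrite Cmod2_alt; unfold Cexp; simpl.
  pose proof (sin2_cos2 (Im z)) as E; unfold Rsqr in E; nra. }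
pose proof (Cmod_ge_0 (Cexp z)); pose proof (exp_pos (Re z)); nra.
Qed.

Lemma Cexp_neq_0 (z : C) : Cexp z <> 0.
Proof.
apply Cmod_gt_0; rewrite Cmod_Cexp; apply exp_pos.
Qed.

Lemma Cexp_opp (z : C) : Cexp (- z) = / Cexp z.
Proof.
pose proof (Cexp_neq_0 z) as Hz.
assert (H : Cexp (- z) * Cexp z = 1).
{ rewrite <- Cexp_plus; replace (- z + z) with (RtoC 0) by ring; apply Cexp_0. }
rewrite <- (Cmult_1_l (/ Cexp z)), <- H; field; exact Hz.
Qed.

Lemma Cexp_pow (z : C) (n : nat) : Cexp z ^ n = Cexp (INR n * z).
Proof.
induction n as [| n IH].
- simpl; rewrite Cmult_0_l; symmetry; apply Cexp_0.
- rewrite Cpow_S, IH, <- Cexp_plus, S_INR, RtoC_plus; f_equal; ring.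
Qed.

Lemma Cexp_2PI (k : Z) : Cexp (2 * PI * Ci * IZR k) = 1.
Proof.
rewrite <- Cexp_0, <- (Cexp_sub_2PI _ k); f_equal; ring.
Qed.

Lemma Cexp_PI : Cexp (PI * Ci) = - (1).
Proof.
unfold Cexp, Cmult, Copp; simpl.
replace (PI * 0 - 0 * 1)%R with 0%R by ring.
replace (PI * 1 + 0 * 0)%R with PI by ring.
rewrite exp_0, cos_PI, sin_PI.
apply injective_projections; simpl; ring.
Qed.

Lemma Cexp_eq_1 (z : C) :
  Cexp z = 1 -> exists k : Z, z = 2 * PI * Ci * IZR k.
Proof.
intros H.
assert (Hr : Re z = 0%R).
{ assert (E : exp (Re z) = exp 0).
  { rewrite <- Cmod_Cexp, H, Cmod_1, exp_0; reflexivity. }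
  now apply exp_inv. }
destruct z as [a b]; unfold Cexp in H; simpl in *; subst a.
rewrite exp_0, !Rmult_1_l in H.
injection H as Hc Hs.
(* Half the angle turns [cos b = 1] into a zero of the sine, and these are the multiples of pi. *)
assert (Hs2 : sin (b / 2) = 0%R).
{ pose proof (cos_2a_sin (b / 2)) as E.
  replace (2 * (b / 2))%R with b in E by field.
  assert (sin (b / 2) * sin (b / 2) = 0)%R by lra; nra. }
destruct (sin_eq_0_0 _ Hs2) as [k Hk].
exists k; apply injective_projections; simpl; lra.
Qed.

Lemma Cmod_le_Re_Im (z : C) : (Cmod z <= Rabs (Re z) + Rabs (Im z))%R.
Proof.
assert (H := Cmod2_alt z).
rewrite <- (pow2_abs (Re z)), <- (pow2_abs (Im z)) in H.
pose proof (Cmod_ge_0 z); pose proof (Rabs_pos (Re z));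
pose proof (Rabs_pos (Im z)); nra.
Qed.

Lemma im_le_Cmod (z : C) : (Rabs (Im z) <= Cmod z)%R.
Proof.
eapply Rle_trans; [| apply Rmax_Cmod]; apply Rmax_r.
Qed.

Lemma Rabs_sin_le (x : R) : (Rabs (sin x) <= Rabs x)%R.
Proof.
assert (Hpos : forall y, (0 < y -> Rabs (sin y) <= y)%R).
{ intros y Hy.
  pose proof (sin_lt_x _ Hy); pose proof (SIN_bound y).
  apply Rabs_le; split; [| lra].
  destruct (Rle_dec y 1); [| lra].
  assert (0 < sin y)%R
    by (apply sin_gt_0; [lra | pose proof PI2_1; lra]).
  lra. }
destruct (Rtotal_order x 0) as [H | [H | H]].
- rewrite <- (Rabs_Ropp (sin x)), <- sin_neg, (Rabs_left x) by lra.
  apply Hpos; lra.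
- rewrite H, sin_0; apply Rle_refl.
- rewrite (Rabs_pos_eq x) by lra; now apply Hpos.
Qed.

Lemma one_sub_cos_bounds (y : R) : (0 <= 1 - cos y <= y * y / 2)%R.
Proof.
pose proof (cos_2a_sin (y / 2)) as E.
replace (2 * (y / 2))%R with y in E by field.
pose proof (Rsqr_le_abs_1 _ _ (Rabs_sin_le (y / 2))) as H; unfold Rsqr in H.
nra.
Qed.

(** Mean value theorem for [sin x - x], whose derivative [cos c - 1] is at most [Rabs c] in absolute
    value. The cubic bound would be sharper; a quadratic one suffices for [Cexp_quadratic]. *)
Lemma Rabs_sin_sub_le (y : R) : (Rabs (sin y - y) <= y * y)%R.
Proof.
destruct (MVT_gen (fun x => sin x - x)%R 0 y (fun x => cos x - 1)%R)
  as [c [Hc E]].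
- intros t _; auto_derive; [trivial | ring].
- intros t _; reg.
- rewrite sin_0 in E.
  replace (sin y - y)%R with ((cos c - 1) * (y - 0))%R by lra.
  rewrite Rabs_mult, Rminus_0_r.
  assert (Hc' : (Rabs c <= Rabs y)%R).
  { unfold Rmin, Rmax in Hc; apply Rabs_le_between.
    destruct (Rle_dec 0 y); [rewrite (Rabs_pos_eq y) | rewrite (Rabs_left y)];
      lra. }
  pose proof (one_sub_cos_bounds c) as Hb; pose proof (COS_bound c).
  rewrite <- (Rabs_Ropp (cos c - 1)), (Rabs_pos_eq (- (cos c - 1))) by lra.
  assert (- (cos c - 1) <= Rabs c)%R.
  { pose proof (Rabs_pos c).
    assert (c * c = Rabs c * Rabs c)%R by (apply (Rsqr_abs c)).
    destruct (Rle_dec (Rabs c) 2); nra. }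
  replace (y * y)%R with (Rabs y * Rabs y)%R
    by (symmetry; apply (Rsqr_abs y)).
  apply Rmult_le_compat_r; [apply Rabs_pos | lra].
Qed.

Lemma exp_le_compat (x y : R) : (x <= y -> exp x <= exp y)%R.
Proof.
intros [H | ->]; [left; now apply exp_increasing | apply Rle_refl].
Qed.

(** Everything follows from [1 + x <= exp x] taken at [x] and at [- x]: multiplied by [exp x], the
    second gives [exp x - 1 <= x * exp x]. *)
Lemma Rabs_exp_sub_1_le (x r : R) :
  (Rabs x <= r)%R ->
  (Rabs (exp x - 1) <= exp r * Rabs x /\
   Rabs (exp x - 1 - x) <= exp r * (x * x))%R.
Proof.
intros H.
pose proof (exp_ineq1_le x) as H1; pose proof (exp_ineq1_le (- x)) as H2.
assert (H3 : (exp x * exp (- x) = 1)%R)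
  by (rewrite <- exp_plus; replace (x + - x)%R with 0%R by ring; apply exp_0).
pose proof (exp_pos x).
assert (H4 : (exp x - 1 <= x * exp x)%R) by nra.
assert (H5 : (exp x <= exp r)%R)
  by (apply exp_le_compat; pose proof (Rle_abs x); lra).
assert (H6 : (1 <= exp r)%R).
{ rewrite <- exp_0; apply exp_le_compat; pose proof (Rabs_pos x); lra. }
destruct (Rle_dec 0 x) as [Hx | Hx].
- rewrite (Rabs_pos_eq x) in * by lra; split; apply Rabs_le; split; nra.
- rewrite (Rabs_left x) in * by lra.
  split; apply Rabs_le; split; nra.
Qed.

(** The source of all differentiability: continuity of [Cexp], the jets of the theta factors and the
    simple zeros of the products are derived from this estimate. *)
Lemma Cexp_quadratic (r : R) :
  exists K, (0 <= K)%R /\ forall z, (Cmod z <= r)%R ->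
    (Cmod (Cexp z - 1 - z) <= K * (Cmod z * Cmod z))%R.
Proof.
(* Real and imaginary part have two error terms each, and each of the four is at most [exp r] times
   the square of the modulus. *)
exists (4 * exp r)%R; split; [pose proof (exp_pos r); lra |].
intros z Hz.
pose proof (re_le_Cmod z) as Hx; pose proof (im_le_Cmod z) as Hy.
eapply Rle_trans; [apply Cmod_le_Re_Im |].
destruct z as [x y]; set (m := Cmod (x, y)) in *; simpl in *.
destruct (Rabs_exp_sub_1_le x r) as [E1 E2]; [lra |].
pose proof (one_sub_cos_bounds y) as E3.
pose proof (Rabs_sin_sub_le y) as E4.
pose proof (Rabs_sin_le y) as E5.
assert (Ex : (x * x <= m * m)%R)
  by (change (Rsqr x <= m * m)%R; rewrite (Rsqr_abs x); unfold Rsqr;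
      pose proof (Rabs_pos x); nra).
assert (Ey : (y * y <= m * m)%R)
  by (change (Rsqr y <= m * m)%R; rewrite (Rsqr_abs y); unfold Rsqr;
      pose proof (Rabs_pos y); nra).
assert (H6 : (1 <= exp r)%R).
{ rewrite <- exp_0; apply exp_le_compat; pose proof (Rabs_pos x); lra. }
assert (H5 : (exp x <= exp r)%R)
  by (apply exp_le_compat; pose proof (Rle_abs x); lra).
pose proof (exp_pos x).
replace (exp x * cos y + - (1) + - x)%R
  with ((exp x - 1 - x) + - (exp x * (1 - cos y)))%R by ring.
replace (exp x * sin y + - 0 + - y)%R
  with ((exp x - 1) * sin y + (sin y - y))%R by ring.
pose proof (Rabs_triang (exp x - 1 - x) (- (exp x * (1 - cos y)))) as T1.
pose proof (Rabs_triang ((exp x - 1) * sin y) (sin y - y)) as T2.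
rewrite Rabs_Ropp, Rabs_mult, (Rabs_pos_eq (exp x)),
  (Rabs_pos_eq (1 - cos y)) in T1 by lra.
rewrite Rabs_mult in T2.
assert (U1 : (exp x * (1 - cos y) <= exp r * (m * m))%R)
  by (apply Rmult_le_compat; lra).
assert (U2 : (Rabs (exp x - 1) * Rabs (sin y) <= (exp r * m) * m)%R).
{ apply Rmult_le_compat; try apply Rabs_pos; [| lra].
  eapply Rle_trans; [apply E1 |]; apply Rmult_le_compat_l; lra. }
assert (U3 : (exp r * (x * x) <= exp r * (m * m))%R)
  by (apply Rmult_le_compat_l; lra).
assert (U4 : (m * m <= exp r * (m * m))%R) by nra.
lra.
Qed.

(** * Limits and infinite products *)

(** Convergence measured by [Cmod], which fits the estimates. The next two lemmas show agreement
    with [filterlim], whose balls in [C] are taken coordinatewise. *)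
Definition tends {T : Type} (F : (T -> Prop) -> Prop) (f : T -> C) (l : C) :=
  forall eps : R, (0 < eps)%R -> F (fun t => (Cmod (f t - l) < eps)%R).

Section Tends.

Context {T : Type} (F : (T -> Prop) -> Prop) {FF : Filter F}.

Lemma tends_filterlim (f : T -> C) (l : C) :
  tends F f l -> filterlim f F (locally l).
Proof.
intros H P [eps HP].
unfold filtermap; generalize (H eps (cond_pos eps)); apply filter_imp.
intros t Ht; apply HP, C_NormedModule_mixin_compat1; exact Ht.
Qed.

Lemma filterlim_tends (f : T -> C) (l : C) :
  filterlim f F (locally l) -> tends F f l.
Proof.
intros H eps Heps.
apply (H (fun y => (Cmod (y - l) < eps)%R)).
assert (H2 : (0 < eps / 2)%R) by lra.
exists (mkposreal _ H2); intros y [H3 H4].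
eapply Rle_lt_trans; [apply Cmod_le_Re_Im |].
change (Rabs (fst y - fst l) < eps / 2)%R in H3.
change (Rabs (snd y - snd l) < eps / 2)%R in H4.
change (Rabs (fst y - fst l) + Rabs (snd y - snd l) < eps)%R; lra.
Qed.

Lemma tends_const (l : C) : tends F (fun _ => l) l.
Proof.
intros eps Heps; apply filter_forall; intros _.
replace (l - l) with (RtoC 0) by ring; now rewrite Cmod_0.
Qed.

Lemma tends_ext (f g : T -> C) (l : C) :
  F (fun t => f t = g t) -> tends F f l -> tends F g l.
Proof.
intros H Hf eps Heps; generalize (filter_and _ _ H (Hf eps Heps)).
apply filter_imp; intros t [-> Ht]; exact Ht.
Qed.

Lemma tends_plus (f g : T -> C) (l m : C) :
  tends F f l -> tends F g m -> tends F (fun t => f t + g t) (l + m).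
Proof.
intros Hf Hg eps Heps.
assert (H2 : (0 < eps / 2)%R) by lra.
generalize (filter_and _ _ (Hf _ H2) (Hg _ H2)); apply filter_imp.
intros t [H3 H4].
replace (f t + g t - (l + m)) with ((f t - l) + (g t - m)) by ring.
eapply Rle_lt_trans; [apply Cmod_triangle | lra].
Qed.

Lemma tends_mult (f g : T -> C) (l m : C) :
  tends F f l -> tends F g m -> tends F (fun t => f t * g t) (l * m).
Proof.
intros Hf Hg eps Heps.
pose proof (Cmod_ge_0 l) as Hl; pose proof (Cmod_ge_0 m) as Hm.
set (B := (1 + Cmod l + Cmod m)%R).
set (d := Rmin 1 (eps / B)).
assert (Hd : (0 < d)%R)
  by (apply Rmin_pos; [lra | apply Rdiv_lt_0_compat; unfold B; lra]).
assert (HdB : (d * B <= eps)%R).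
{ replace eps with (eps / B * B)%R by (field; unfold B; lra).
  apply Rmult_le_compat_r; [unfold B; lra | apply Rmin_r]. }
assert (Hd1 : (d <= 1)%R) by apply Rmin_l.
generalize (filter_and _ _ (Hf _ Hd) (Hg _ Hd)); apply filter_imp.
intros t [H3 H4].
replace (f t * g t - l * m)
  with ((f t - l) * (g t - m) + (l * (g t - m) + (f t - l) * m)) by ring.
eapply Rle_lt_trans; [apply Cmod_triangle |].
eapply Rle_lt_trans;
  [apply Rplus_le_compat_l, Cmod_triangle |].
rewrite !Cmod_mult.
pose proof (Cmod_ge_0 (f t - l)); pose proof (Cmod_ge_0 (g t - m)).
unfold B in HdB; nra.
Qed.

Lemma tends_opp (f : T -> C) (l : C) :
  tends F f l -> tends F (fun t => - f t) (- l).
Proof.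
intros Hf eps Heps; generalize (Hf eps Heps); apply filter_imp; intros t Ht.
replace (- f t - - l) with (- (f t - l)) by ring; now rewrite Cmod_opp.
Qed.

Lemma tends_minus (f g : T -> C) (l m : C) :
  tends F f l -> tends F g m -> tends F (fun t => f t - g t) (l - m).
Proof.
intros Hf Hg; now apply tends_plus, tends_opp.
Qed.

Lemma tends_neq_0 (f : T -> C) (l : C) :
  tends F f l -> l <> 0 -> F (fun t => f t <> 0).
Proof.
intros Hf Hl; apply Cmod_gt_0 in Hl.
generalize (Hf _ Hl); apply filter_imp; intros t Ht E.
rewrite E in Ht; replace (0 - l) with (- l) in Ht by ring.
rewrite Cmod_opp in Ht; lra.
Qed.

Lemma tends_inv (f : T -> C) (l : C) :
  tends F f l -> l <> 0 -> tends F (fun t => / f t) (/ l).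
Proof.
intros Hf Hl eps Heps.
assert (Hl0 := proj1 (Cmod_gt_0 l) Hl).
assert (H1 : (0 < Cmod l / 2)%R) by lra.
assert (H2 : (0 < eps * (Cmod l * Cmod l / 2))%R)
  by (repeat apply Rmult_lt_0_compat; lra).
generalize (filter_and _ _ (Hf _ H1) (Hf _ H2)).
apply filter_imp; intros t [H3 H4].
assert (H5 : (Cmod l / 2 < Cmod (f t))%R).
{ assert (Cmod l <= Cmod (f t) + Cmod (f t - l))%R.
  { rewrite <- (Cmod_opp (f t - l)).
    replace l with (f t + - (f t - l)) at 1 by ring; apply Cmod_triangle. }
  lra. }
assert (Hft : f t <> 0) by (apply Cmod_gt_0; lra).
replace (/ f t - / l) with (- ((f t - l) / (f t * l))) by (field; auto).
rewrite Cmod_opp, Cmod_div, Cmod_mult by now apply Cmult_neq_0.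
apply (proj2 (Rlt_div_l _ _ _ (Rmult_lt_0_compat _ _ (Rlt_trans _ _ _ H1 H5) Hl0))).
eapply Rlt_le_trans; [apply H4 |].
apply Rmult_le_compat_l; nra.
Qed.

Lemma tends_div (f g : T -> C) (l m : C) :
  tends F f l -> tends F g m -> m <> 0 -> tends F (fun t => f t / g t) (l / m).
Proof.
intros Hf Hg Hm; apply tends_mult; [exact Hf | now apply tends_inv].
Qed.

Lemma tends_Cprod (f : nat -> T -> C) (l : nat -> C) (n : nat) :
  (forall j, tends F (f j) (l j)) ->
  tends F (fun t => Cprod (fun j => f j t) n) (Cprod l n).
Proof.
intros H; induction n as [| n IH]; simpl.
- apply tends_const.
- now apply tends_mult.
Qed.

Lemma tends_pow (f : T -> C) (l : C) (n : nat) :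
  tends F f l -> tends F (fun t => f t ^ n) (l ^ n).
Proof.
intros H; induction n as [| n IH]; simpl.
- apply tends_const.
- now apply tends_mult.
Qed.

Lemma tends_Cexp (f : T -> C) (l : C) :
  tends F f l -> tends F (fun t => Cexp (f t)) (Cexp l).
Proof.
intros H.
(* The functional equation reduces continuity at [l] to continuity at 0. *)
assert (H0 : tends F (fun t => Cexp (f t - l)) 1).
{ destruct (Cexp_quadratic 1) as [K [HK HE]].
  intros eps Heps.
  set (d := Rmin 1 (eps / (K + 2))).
  assert (Hd : (0 < d)%R)
    by (apply Rmin_pos; [lra | apply Rdiv_lt_0_compat; lra]).
  assert (HdB : (d * (K + 2) <= eps)%R).
  { replace eps with (eps / (K + 2) * (K + 2))%R by (field; lra).
    apply Rmult_le_compat_r; [lra | apply Rmin_r]. }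
  assert (Hd1 : (d <= 1)%R) by apply Rmin_l.
  generalize (H d Hd); apply filter_imp; intros t Ht.
  pose proof (HE (f t - l)) as E.
  replace (Cexp (f t - l) - 1)
    with ((Cexp (f t - l) - 1 - (f t - l)) + (f t - l)) by ring.
  eapply Rle_lt_trans; [apply Cmod_triangle |].
  pose proof (Cmod_ge_0 (f t - l)).
  assert (H2 : (Cmod (f t - l) <= 1)%R) by lra.
  specialize (E H2).
  assert (K * (Cmod (f t - l) * Cmod (f t - l)) <= K * Cmod (f t - l))%R
    by (apply Rmult_le_compat_l; nra).
  assert (K * Cmod (f t - l) <= K * d)%R by nra.
  nra. }
pose proof (tends_mult _ _ _ _ (tends_const (Cexp l)) H0) as H1.
rewrite Cmult_1_r in H1; revert H1; apply tends_ext, filter_forall; intros t.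
rewrite <- Cexp_plus; f_equal; ring.
Qed.

End Tends.

Lemma tends_unique {T : Type} (F : (T -> Prop) -> Prop) {FF : ProperFilter F}
  (f : T -> C) (l m : C) :
  tends F f l -> tends F f m -> l = m.
Proof.
intros Hl Hm.
rewrite <- (Clim_unique f F FF l (tends_filterlim F f l Hl)).
exact (Clim_unique f F FF m (tends_filterlim F f m Hm)).
Qed.

Lemma Clim_tends {T : Type} (F : (T -> Prop) -> Prop) {FF : ProperFilter F}
  (f : T -> C) (l : C) :
  tends F f l -> Clim f F = l.
Proof.
intros H; exact (Clim_unique f F FF l (tends_filterlim F f l H)).
Qed.

Lemma tends_le {T : Type} (F : (T -> Prop) -> Prop) {FF : ProperFilter F}
  (f : T -> C) (l a : C) (b : R) :
  tends F f l -> F (fun t => (Cmod (f t - a) <= b)%R) -> (Cmod (l - a) <= b)%R.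
Proof.
intros H H1; apply le_epsilon; intros eps Heps.
destruct (filter_ex _ (filter_and _ _ H1 (H eps Heps))) as [t [H2 H3]].
rewrite <- Cmod_opp in H3.
replace (l - a) with (- (f t - l) + (f t - a)) by ring.
eapply Rle_trans; [apply Cmod_triangle | lra].
Qed.

(** [Clim] is the limit supplied by completeness, so a Cauchy sequence converges to it without any
    candidate being known. The infinite products obtain their values in this way. *)
Lemma Cauchy_tends (u : nat -> C) :
  (forall eps : R, (0 < eps)%R ->
     exists n, forall m, (n <= m)%nat -> (Cmod (u m - u n) < eps)%R) ->
  tends eventually u (Clim u eventually).
Proof.
intros H; apply filterlim_tends.
intros P [eps HP].
assert (Hb : filtermap u eventually (ball (C_complete_lim (filtermap u eventually)) eps)).
{ apply C_complete_ax1.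
  - apply filtermap_proper_filter, eventually_filter.
  - intros e; destruct (H e (cond_pos e)) as [n Hn].
    exists (u n); exists n; intros m Hm.
    now apply C_NormedModule_mixin_compat1, Hn. }
revert Hb; unfold filtermap; apply filter_imp; intros t; apply HP.
Qed.

(** The expression is the tail bound of [qprod_cauchy], a constant times [r ^ n]. *)
Lemma exp_tail_small (b r eps : R) :
  (0 <= r < 1)%R -> (0 < eps)%R ->
  exists n, (exp (b / (1 - r)) * b * r ^ n / (1 - r) < eps)%R.
Proof.
intros Hr Heps.
set (c := (Rabs (exp (b / (1 - r)) * b / (1 - r)) + 1)%R).
assert (Hc : (0 < c)%R)
  by (unfold c; pose proof (Rabs_pos (exp (b / (1 - r)) * b / (1 - r))); lra).
destruct (pow_lt_1_zero r) with (y := (eps / c)%R) as [n Hn].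
- rewrite Rabs_pos_eq; lra.
- now apply Rdiv_lt_0_compat.
- exists n; specialize (Hn n (le_n n)).
  pose proof (pow_le r n (proj1 Hr)) as Hp.
  rewrite Rabs_pos_eq in Hn by exact Hp.
  apply Rlt_div_r in Hn; [| exact Hc].
  eapply Rle_lt_trans; [| apply Hn].
  replace (exp (b / (1 - r)) * b * r ^ n / (1 - r))%R
    with (r ^ n * (exp (b / (1 - r)) * b / (1 - r)))%R by (field; lra).
  apply Rmult_le_compat_l; [exact Hp |].
  pose proof (Rle_abs (exp (b / (1 - r)) * b / (1 - r))); unfold c; lra.
Qed.

(** * Infinite q-products: convergence, joint continuity, zeros *)

Definition qprod (x q : C) : nat -> C := Cprod (fun j => 1 - x * q ^ j).

Section QProd.

Variables (b r : R) (x q : C).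
Hypotheses (Hr : (0 <= r < 1)%R) (Hx : (Cmod x <= b)%R) (Hq : (Cmod q <= r)%R).

Lemma Cmod_qterm (j : nat) : (Cmod (x * q ^ j) <= b * r ^ j)%R.
Proof.
rewrite Cmod_mult, Cmod_pow.
apply Rmult_le_compat; auto using Cmod_ge_0, pow_le.
apply pow_incr; split; [apply Cmod_ge_0 | exact Hq].
Qed.

(** Since [1 + u <= exp u], the bounds of the factors multiply to the exponential of a partial
    geometric sum. The majorants [b] and [r] replace the moduli of [x] and [q] so that the estimates
    hold uniformly near a given pair of parameters. *)
Lemma Cmod_qprod (n : nat) :
  (Cmod (qprod x q n) <= exp (b * (1 - r ^ n) / (1 - r)))%R.
Proof.
induction n as [| n IH].
- unfold qprod; simpl; rewrite Cmod_1.
  replace (b * (1 - 1) / (1 - r))%R with 0%R by (field; lra).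
  rewrite exp_0; apply Rle_refl.
- unfold qprod in *; simpl Cprod; rewrite Cmod_mult.
  replace (b * (1 - r ^ S n) / (1 - r))%R
    with (b * (1 - r ^ n) / (1 - r) + b * r ^ n)%R
    by (rewrite <- tech_pow_Rmult; field; lra).
  rewrite exp_plus; apply Rmult_le_compat; try apply Cmod_ge_0; [exact IH |].
  eapply Rle_trans; [apply Cmod_triangle |].
  rewrite Cmod_opp, Cmod_1.
  pose proof (Cmod_qterm n); pose proof (exp_ineq1_le (b * r ^ n)); lra.
Qed.

Lemma Cmod_qprod_uniform (n : nat) :
  (Cmod (qprod x q n) <= exp (b / (1 - r)))%R.
Proof.
eapply Rle_trans; [apply Cmod_qprod | apply exp_le_compat].
apply Rmult_le_compat_r; [left; apply Rinv_0_lt_compat; lra |].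
pose proof (pow_le r n (proj1 Hr)); pose proof (Cmod_ge_0 x); nra.
Qed.

(** Consecutive partial products differ by a bounded product times a geometric term. The factor
    [1 - r ^ p] records the partial geometric sum, so that the induction closes. *)
Lemma qprod_sub (m p : nat) :
  (Cmod (qprod x q (m + p) - qprod x q m)
   <= exp (b / (1 - r)) * b * r ^ m * (1 - r ^ p) / (1 - r))%R.
Proof.
pose proof (exp_pos (b / (1 - r))) as HE.
induction p as [| p IH].
- rewrite Nat.add_0_r; replace (_ - _) with (RtoC 0) by ring.
  rewrite Cmod_0; right; simpl; field; lra.
- rewrite Nat.add_succ_r; unfold qprod in *; simpl Cprod.
  set (P := Cprod _ (m + p)) in *.
  replace (_ - _) with ((P - Cprod (fun j => 1 - x * q ^ j) m)
                        + - (P * (x * q ^ (m + p)))) by ring.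
  eapply Rle_trans; [apply Cmod_triangle |].
  rewrite Cmod_opp, Cmod_mult.
  replace (exp (b / (1 - r)) * b * r ^ m * (1 - r ^ S p) / (1 - r))%R
    with (exp (b / (1 - r)) * b * r ^ m * (1 - r ^ p) / (1 - r)
          + exp (b / (1 - r)) * (b * r ^ (m + p)))%R
    by (rewrite pow_add, <- tech_pow_Rmult; field; lra).
  apply Rplus_le_compat; [exact IH |].
  apply Rmult_le_compat; try apply Cmod_ge_0;
    [apply Cmod_qprod_uniform | apply Cmod_qterm].
Qed.

Lemma qprod_cauchy (m n : nat) :
  (m <= n)%nat ->
  (Cmod (qprod x q n - qprod x q m)
   <= exp (b / (1 - r)) * b * r ^ m / (1 - r))%R.
Proof.
intros H; replace n with (m + (n - m))%nat by lia.
eapply Rle_trans; [apply qprod_sub |].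
apply Rmult_le_compat_r; [left; apply Rinv_0_lt_compat; lra |].
rewrite <- (Rmult_1_r (_ * r ^ m)) at 2; apply Rmult_le_compat_l.
- pose proof (Cmod_ge_0 x).
  repeat apply Rmult_le_pos; auto using pow_le with real.
  + left; apply exp_pos.
  + lra.
  + apply pow_le; lra.
- pose proof (pow_le r (n - m) (proj1 Hr)); lra.
Qed.

Lemma tends_qprod : tends eventually (qprod x q) (qpoch x q).
Proof.
apply Cauchy_tends; intros eps Heps.
destruct (exp_tail_small b r eps Hr Heps) as [n Hn]; exists n; intros m Hm.
eapply Rle_lt_trans; [now apply qprod_cauchy | exact Hn].
Qed.

Lemma qpoch_tail (m : nat) :
  (Cmod (qpoch x q - qprod x q m)
   <= exp (b / (1 - r)) * b * r ^ m / (1 - r))%R.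
Proof.
apply (tends_le eventually (qprod x q)); [exact tends_qprod |].
exists m; intros n Hn; now apply qprod_cauchy.
Qed.

End QProd.

Lemma qpoch_tends (x q : C) :
  (Cmod q < 1)%R -> tends eventually (qprod x q) (qpoch x q).
Proof.
intros H; apply (tends_qprod (Cmod x) (Cmod q)); auto using Rle_refl.
split; [apply Cmod_ge_0 | exact H].
Qed.

(** Three-epsilon argument: the finite product is continuous, and both tails are small uniformly on
    the neighbourhood where [x] moves by less than 1 and the modulus of [q] stays below the midpoint
    between its value and 1. Continuity in [q] is what later allows [tau] to vary. *)
Lemma tends_qpoch {T : Type} (F : (T -> Prop) -> Prop) {FF : Filter F}
  (X Q : T -> C) (x q : C) :
  (Cmod q < 1)%R -> tends F X x -> tends F Q q ->
  tends F (fun t => qpoch (X t) (Q t)) (qpoch x q).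
Proof.
intros Hq HX HQ eps Heps.
set (b := (Cmod x + 1)%R); set (r := ((1 + Cmod q) / 2)%R).
pose proof (Cmod_ge_0 q) as Hq0.
assert (Hr : (0 <= r < 1)%R) by (unfold r; lra).
destruct (exp_tail_small b r (eps / 3)) as [n Hn]; [exact Hr | lra |].
assert (HP : tends F (fun t => qprod (X t) (Q t) n) (qprod x q n)).
{ apply (tends_Cprod F (fun j t => 1 - X t * Q t ^ j)); intros j.
  apply tends_minus; [exact FF | now apply tends_const |].
  apply tends_mult; [exact FF | exact HX | now apply tends_pow]. }
assert (He : (0 < eps / 3)%R) by lra.
assert (Hr' : (0 < r - Cmod q)%R) by (unfold r; lra).
generalize (filter_and _ _ (HP _ He)
  (filter_and _ _ (HX 1%R Rlt_0_1) (HQ _ Hr'))).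
apply filter_imp; intros t [H1 [H2 H3]].
assert (HXb : (Cmod (X t) <= b)%R).
{ replace (X t) with ((X t - x) + x) by ring.
  eapply Rle_trans; [apply Cmod_triangle | unfold b; lra]. }
assert (HQr : (Cmod (Q t) <= r)%R).
{ replace (Q t) with ((Q t - q) + q) by ring.
  eapply Rle_trans; [apply Cmod_triangle | lra]. }
assert (Hxb : (Cmod x <= b)%R) by (unfold b; lra).
assert (Hqr : (Cmod q <= r)%R) by (unfold r; lra).
pose proof (qpoch_tail b r _ _ Hr HXb HQr n) as T1.
pose proof (qpoch_tail b r _ _ Hr Hxb Hqr n) as T2.
rewrite <- Cmod_opp in T2.
replace (qpoch (X t) (Q t) - qpoch x q)
  with ((qpoch (X t) (Q t) - qprod (X t) (Q t) n)
        + ((qprod (X t) (Q t) n - qprod x q n)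
           + - (qpoch x q - qprod x q n))) by ring.
eapply Rle_lt_trans; [apply Cmod_triangle |].
eapply Rle_lt_trans; [apply Rplus_le_compat_l, Cmod_triangle |]; lra.
Qed.

Lemma qprod_split (x q : C) (m n : nat) :
  qprod x q (m + n) = qprod x q m * qprod (x * q ^ m) q n.
Proof.
induction n as [| n IH].
- rewrite Nat.add_0_r; unfold qprod; simpl; ring.
- rewrite Nat.add_succ_r; unfold qprod in *; simpl Cprod.
  rewrite IH, Cpow_add_r; ring.
Qed.

Lemma tends_shift (u : nat -> C) (l : C) (f : nat -> nat) :
  (forall n, (n <= f n)%nat) ->
  tends eventually u l -> tends eventually (fun n => u (f n)) l.
Proof.
intros Hf H eps Heps; destruct (H eps Heps) as [n Hn]; exists n; intros m Hm.
apply Hn; specialize (Hf m); lia.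
Qed.

Lemma qpoch_split (x q : C) (m : nat) :
  (Cmod q < 1)%R -> qpoch x q = qprod x q m * qpoch (x * q ^ m) q.
Proof.
intros Hq.
apply (tends_unique eventually (fun n => qprod x q (m + n))).
- apply tends_shift; [lia | now apply qpoch_tends].
- apply (tends_ext _ (fun n => qprod x q m * qprod (x * q ^ m) q n)).
  + apply filter_forall; intros n; symmetry; apply qprod_split.
  + apply tends_mult; [exact _ | apply tends_const; exact _ |].
    now apply qpoch_tends.
Qed.

Lemma qprod_1 (x q : C) : qprod x q 1 = 1 - x.
Proof. unfold qprod; simpl; ring. Qed.

Lemma qpoch_step (x q : C) :
  (Cmod q < 1)%R -> qpoch x q = (1 - x) * qpoch (x * q) q.
Proof.
intros Hq; rewrite (qpoch_split x q 1 Hq), qprod_1, Cpow_1_r; reflexivity.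
Qed.

Lemma qprod_neq_0 (x q : C) (n : nat) :
  (forall j, (j < n)%nat -> x * q ^ j <> 1) -> qprod x q n <> 0.
Proof.
induction n as [| n IH]; intros H; unfold qprod; simpl.
- exact C1_nz.
- apply Cmult_neq_0; [apply IH; auto |].
  intros E; apply (H n); [lia |].
  replace (x * q ^ n) with (1 - (1 - x * q ^ n)) by ring; rewrite E; ring.
Qed.

(** Split off so many factors that the remaining infinite product has distance less than 1 from 1;
    the finitely many factors split off are nonzero by assumption. *)
Lemma qpoch_neq_0 (x q : C) :
  (Cmod q < 1)%R -> (forall j, x * q ^ j <> 1) -> qpoch x q <> 0.
Proof.
intros Hq Hx.
pose proof (Cmod_ge_0 q) as Hq0; pose proof (Cmod_ge_0 x) as Hx0.
destruct (exp_tail_small (Cmod x) (Cmod q) 1) as [m Hm]; [lra | lra |].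
rewrite (qpoch_split x q m Hq); apply Cmult_neq_0.
- apply qprod_neq_0; auto.
- assert (T : (Cmod (qpoch (x * q ^ m) q - 1) < 1)%R).
  { eapply Rle_lt_trans; [| apply Hm].
    change (RtoC 1) with (qprod (x * q ^ m) q 0).
    eapply Rle_trans.
    - apply (qpoch_tail (Cmod x * Cmod q ^ m) (Cmod q)); [lra | | lra].
      rewrite Cmod_mult, Cmod_pow; apply Rle_refl.
    - rewrite pow_O, Rmult_1_r.
      assert (0 <= Cmod q ^ m <= 1)%R.
      { split; [now apply pow_le |].
        rewrite <- (pow1 m); apply pow_incr; lra. }
      apply Rmult_le_compat_r; [left; apply Rinv_0_lt_compat; lra |].
      rewrite Rmult_assoc; apply Rmult_le_compat_r; [nra |].
      apply exp_le_compat, Rmult_le_compat_r;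
        [left; apply Rinv_0_lt_compat; lra | nra]. }
  intros E; rewrite E in T.
  replace (0 - 1) with (- (1)) in T by ring.
  rewrite Cmod_m1 in T; lra.
Qed.

(** * Theta products are locally uniformly differentiable *)

Lemma Cmod_plus_le (a b : C) (A B : R) :
  (Cmod a <= A -> Cmod b <= B -> Cmod (a + b)%C <= A + B)%R.
Proof.
intros; eapply Rle_trans; [apply Cmod_triangle | lra].
Qed.

Lemma Cmod_mult_le (a b : C) (A B : R) :
  (Cmod a <= A -> Cmod b <= B -> Cmod (a * b)%C <= A * B)%R.
Proof.
intros; rewrite Cmod_mult; apply Rmult_le_compat; auto using Cmod_ge_0.
Qed.

Lemma Cminus_0_r (z : C) : z - 0 = z.
Proof. ring. Qed.

(* The total bound on value, derivative and quadratic remainder is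
   submultiplicative, which makes it uniform along infinite products. *)
Definition jet (f : C -> C) (v : C) (B : R) : Prop :=
  exists (d : C) (K0 K1 K2 : R),
    (0 <= K2 /\ Cmod (f v) <= K0 /\ Cmod d <= K1 /\
    (forall t : C, Cmod t <= 1 ->
       Cmod (f (v + t)%C - f v - t * d)%C <= K2 * (Cmod t * Cmod t)) /\
    K0 + K1 + K2 <= B)%R.

Lemma jet_le (f : C -> C) (v : C) (A B : R) :
  (A <= B)%R -> jet f v A -> jet f v B.
Proof.
intros H (d & K0 & K1 & K2 & H1 & H2 & H3 & H4 & H5).
exists d, K0, K1, K2; repeat split; auto; lra.
Qed.

(** Expand the product of two first-order expansions with remainder. For increments of modulus at
    most 1 the terms of order three and four are dominated by the quadratic one, so the new
    constants are exactly the nine terms of [(K0 + K1 + K2) * (L0 + L1 + L2)]. *)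
Lemma jet_mult (f g : C -> C) (v : C) (A B : R) :
  jet f v A -> jet g v B -> jet (fun w => f w * g w) v (A * B).
Proof.
intros (d & K0 & K1 & K2 & H1 & H2 & H3 & H4 & H5)
       (e & L0 & L1 & L2 & G1 & G2 & G3 & G4 & G5).
pose proof (Cmod_ge_0 (f v)) as P1; pose proof (Cmod_ge_0 (g v)) as P2.
pose proof (Cmod_ge_0 d) as P3; pose proof (Cmod_ge_0 e) as P4.
assert (HK0 : (0 <= K0)%R) by lra; assert (HK1 : (0 <= K1)%R) by lra.
assert (HL0 : (0 <= L0)%R) by lra; assert (HL1 : (0 <= L1)%R) by lra.
exists (f v * e + d * g v), (K0 * L0)%R, (K0 * L1 + K1 * L0)%R,
  (K0 * L2 + K1 * L1 + K1 * L2 + K2 * L0 + K2 * L1 + K2 * L2)%R.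
repeat split.
- assert (0 <= K0 * L2)%R by now apply Rmult_le_pos.
  assert (0 <= K1 * L1)%R by now apply Rmult_le_pos.
  assert (0 <= K1 * L2)%R by now apply Rmult_le_pos.
  assert (0 <= K2 * L0)%R by now apply Rmult_le_pos.
  assert (0 <= K2 * L1)%R by now apply Rmult_le_pos.
  assert (0 <= K2 * L2)%R by now apply Rmult_le_pos.
  lra.
- rewrite Cmod_mult; apply Rmult_le_compat; assumption.
- eapply Rle_trans; [apply Cmod_triangle |]; rewrite !Cmod_mult.
  apply Rplus_le_compat; apply Rmult_le_compat; assumption.
- intros t Ht; specialize (H4 t Ht); specialize (G4 t Ht).
  set (rho := f (v + t) - f v - t * d) in *.
  set (sig := g (v + t) - g v - t * e) in *.
  set (m := Cmod t) in *.
  assert (Hm : (0 <= m)%R) by apply Cmod_ge_0.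
  replace (f (v + t) * g (v + t) - f v * g v - t * (f v * e + d * g v))
    with (f v * sig + (t * d) * (t * e) + (t * d) * sig + rho * g v
          + rho * (t * e) + rho * sig) by (unfold rho, sig; ring).
  assert (Hmm : (m * m * m <= m * m)%R).
  { rewrite <- (Rmult_1_r (m * m)) at 2.
    apply Rmult_le_compat_l; [now apply Rmult_le_pos | exact Ht]. }
  assert (Hmm0 : (0 <= m * m)%R) by now apply Rmult_le_pos.
  assert (Hmm4 : (m * m * (m * m) <= m * m)%R).
  { rewrite <- (Rmult_1_r (m * m)) at 3.
    apply Rmult_le_compat_l; [exact Hmm0 |].
    rewrite <- (Rmult_1_r 1); now apply Rmult_le_compat. }
  assert (Hd : (Cmod (t * d) <= m * K1)%R)
    by (apply Cmod_mult_le; [apply Rle_refl | exact H3]).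
  assert (He : (Cmod (t * e) <= m * L1)%R)
    by (apply Cmod_mult_le; [apply Rle_refl | exact G3]).
  set (td := t * d) in *; set (te := t * e) in *.
  clearbody rho sig td te; eapply Rle_trans.
  { repeat (apply Cmod_plus_le || apply Cmod_mult_le); eassumption. }
  assert (E1 : (K1 * L2 * (m * m * m) <= K1 * L2 * (m * m))%R)
    by (apply Rmult_le_compat_l; [now apply Rmult_le_pos | exact Hmm]).
  assert (E2 : (K2 * L1 * (m * m * m) <= K2 * L1 * (m * m))%R)
    by (apply Rmult_le_compat_l; [now apply Rmult_le_pos | exact Hmm]).
  assert (E3 : (K2 * L2 * (m * m * (m * m)) <= K2 * L2 * (m * m))%R)
    by (apply Rmult_le_compat_l; [now apply Rmult_le_pos | exact Hmm4]).
  lra.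
- assert ((K0 + K1 + K2) * (L0 + L1 + L2) <= A * B)%R
    by (apply Rmult_le_compat; lra).
  lra.
Qed.

(** Covers both the Gaussian factor and the exponentials inside the products. The increment of the
    exponent is [z], at most [rho] times the increment of the variable on the disc of radius [R0],
    and [Cexp_quadratic] applies on the disc of radius [rho]. *)
Lemma jet_Cexp_quadratic (a l : C) (R0 : R) :
  exists B, (0 <= B)%R /\ forall v, (Cmod v <= R0)%R ->
    jet (fun w => Cexp (a * w * w + l * w)) v B.
Proof.
set (rho := (2 * Cmod a * Rabs R0 + Cmod l + Cmod a)%R).
assert (Hrho : (0 <= rho)%R).
{ pose proof (Cmod_ge_0 a); pose proof (Cmod_ge_0 l);
  pose proof (Rabs_pos R0); unfold rho; nra. }
destruct (Cexp_quadratic rho) as [K [HK HE]].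
set (G := exp (Cmod a * Rabs R0 * Rabs R0 + Cmod l * Rabs R0)).
pose proof (exp_pos (Cmod a * Rabs R0 * Rabs R0 + Cmod l * Rabs R0)) as HG.
fold G in HG.
pose proof (Cmod_ge_0 a) as Ha; pose proof (Cmod_ge_0 l) as Hl.
exists (G + G * rho + G * (K * (rho * rho) + Cmod a))%R; split.
{ assert (0 <= G * rho)%R by nra.
  assert (0 <= G * (K * (rho * rho) + Cmod a))%R
    by (apply Rmult_le_pos; [lra |]; assert (0 <= rho * rho)%R by nra; nra).
  lra. }
intros v Hv; pose proof (Cmod_ge_0 v) as Hv0.
assert (HvR : (Cmod v <= Rabs R0)%R)
  by (eapply Rle_trans; [exact Hv | apply Rle_abs]).
assert (HfG : (Cmod (Cexp (a * v * v + l * v)) <= G)%R).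
{ rewrite Cmod_Cexp; apply exp_le_compat.
  eapply Rle_trans; [apply Rle_abs |].
  eapply Rle_trans; [apply re_le_Cmod |].
  repeat (apply Cmod_plus_le || apply Cmod_mult_le); auto using Rle_refl. }
assert (Hd : (Cmod (2 * a * v + l) <= 2 * Cmod a * Rabs R0 + Cmod l)%R).
{ repeat (apply Cmod_plus_le || apply Cmod_mult_le); auto using Rle_refl.
  rewrite Cmod_R, Rabs_pos_eq; lra. }
exists (Cexp (a * v * v + l * v) * (2 * a * v + l)), G, (G * rho)%R,
  (G * (K * (rho * rho) + Cmod a))%R.
repeat split.
- apply Rmult_le_pos; [lra |]; assert (0 <= rho * rho)%R by nra; nra.
- exact HfG.
- apply Cmod_mult_le; [exact HfG |]; unfold rho; lra.
- intros t Ht; pose proof (Cmod_ge_0 t) as Ht0.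
  set (z := t * (2 * a * v + l) + a * t * t).
  assert (Hz : (Cmod z <= rho * Cmod t)%R).
  { unfold z, rho.
    eapply Rle_trans.
    { apply Cmod_plus_le; [apply Cmod_mult_le; [apply Rle_refl | exact Hd] |].
      repeat apply Cmod_mult_le; apply Rle_refl. }
    assert (Cmod a * Cmod t * Cmod t <= Cmod a * Cmod t)%R.
    { rewrite <- (Rmult_1_r (Cmod a * Cmod t)) at 2.
      apply Rmult_le_compat_l; nra. }
    lra. }
  assert (Hz1 : (Cmod z <= rho)%R) by nra.
  specialize (HE z Hz1); pose proof (Cmod_ge_0 z) as Hz0.
  replace (Cexp (a * (v + t) * (v + t) + l * (v + t)) -
    Cexp (a * v * v + l * v) - t * (Cexp (a * v * v + l * v) * (2 * a * v + l)))
    with (Cexp (a * v * v + l * v) * ((Cexp z - 1 - z) + a * (t * t))).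
  2: { replace (a * (v + t) * (v + t) + l * (v + t))
         with ((a * v * v + l * v) + z) by (unfold z; ring).
       rewrite (Cexp_plus (a * v * v + l * v) z).
       generalize (Cexp z); intros e; unfold z; ring. }
  replace (G * (K * (rho * rho) + Cmod a) * (Cmod t * Cmod t))%R
    with (G * ((K * ((rho * Cmod t) * (rho * Cmod t))
               + Cmod a * (Cmod t * Cmod t))))%R by ring.
  apply Cmod_mult_le; [exact HfG |].
  apply Cmod_plus_le.
  + eapply Rle_trans; [exact HE |]; apply Rmult_le_compat_l; [exact HK |].
    now apply Rmult_le_compat.
  + apply Cmod_mult_le; [apply Rle_refl |]; rewrite Cmod_mult; apply Rle_refl.
- lra.
Qed.

Lemma jet_const (c v : C) : jet (fun _ => c) v (Cmod c).
Proof.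
exists 0, (Cmod c), 0%R, 0%R; rewrite Cmod_0; repeat split; try lra.
intros t _; replace (c - c - t * 0) with (RtoC 0) by ring; rewrite Cmod_0; lra.
Qed.

Lemma jet_one_sub (f : C -> C) (c v : C) (G : R) :
  jet f v G -> jet (fun w => 1 - c * f w) v (1 + Cmod c * G).
Proof.
intros (d & K0 & K1 & K2 & H1 & H2 & H3 & H4 & H5).
pose proof (Cmod_ge_0 c) as Hc.
exists (- (c * d)), (1 + Cmod c * K0)%R, (Cmod c * K1)%R, (Cmod c * K2)%R.
repeat split.
- now apply Rmult_le_pos.
- apply Cmod_plus_le; [rewrite Cmod_1; lra |].
  rewrite Cmod_opp; apply Cmod_mult_le; [apply Rle_refl | exact H2].
- rewrite Cmod_opp; apply Cmod_mult_le; [apply Rle_refl | exact H3].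
- intros t Ht.
  replace (1 - c * f (v + t) - (1 - c * f v) - t * - (c * d))
    with (- (c * (f (v + t) - f v - t * d))) by ring.
  rewrite Cmod_opp, Rmult_assoc.
  apply Cmod_mult_le; [apply Rle_refl | now apply H4].
- nra.
Qed.

Lemma jet_ext (f g : C -> C) (v : C) (B : R) :
  (forall w, f w = g w) -> jet f v B -> jet g v B.
Proof.
intros H (d & K0 & K1 & K2 & H1 & H2 & H3 & H4 & H5).
exists d, K0, K1, K2; repeat split; auto.
- now rewrite <- H.
- intros t Ht; rewrite <- !H; now apply H4.
Qed.

(** Submultiplicativity lets the argument of [Cmod_qprod] run for jets: the bounds [1 + u] of the
    factors become a geometric sum in the exponent, independent of [n]. *)
Lemma jet_qprod (f : C -> C) (c Q v : C) (G : R) (n : nat) :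
  (Cmod Q < 1)%R -> jet f v G -> (0 <= G)%R ->
  jet (fun w => qprod (c * f w) Q n) v (exp (Cmod c * G / (1 - Cmod Q))).
Proof.
intros HQ Hf HG.
pose proof (Cmod_ge_0 Q) as HQ0; pose proof (Cmod_ge_0 c) as Hc.
apply jet_le with
  (exp (Cmod c * G * (1 - Cmod Q ^ n) / (1 - Cmod Q))).
{ apply exp_le_compat, Rmult_le_compat_r;
    [left; apply Rinv_0_lt_compat; lra |].
  pose proof (pow_le _ n HQ0).
  assert (0 <= Cmod c * G)%R by now apply Rmult_le_pos.
  nra. }
induction n as [| n IH].
- simpl; replace (Cmod c * G * (1 - 1) / (1 - Cmod Q))%R with 0%R
    by (field; lra).
  rewrite exp_0; apply (jet_ext (fun _ => 1)); [reflexivity |].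
  apply (jet_le _ _ (Cmod 1)); [rewrite Cmod_1; lra | apply jet_const].
- replace (Cmod c * G * (1 - Cmod Q ^ S n) / (1 - Cmod Q))%R
    with (Cmod c * G * (1 - Cmod Q ^ n) / (1 - Cmod Q)
          + Cmod c * Cmod Q ^ n * G)%R
    by (rewrite <- tech_pow_Rmult; field; lra).
  rewrite exp_plus.
  apply (jet_mult (fun w => qprod (c * f w) Q n)
           (fun w => 1 - c * f w * Q ^ n)); [exact IH |].
  apply (jet_ext (fun w => 1 - (c * Q ^ n) * f w)); [intros w; ring |].
  eapply jet_le; [| exact (jet_one_sub f (c * Q ^ n) v G Hf)].
  rewrite Cmod_mult, Cmod_pow; apply exp_ineq1_le.
Qed.

(* Complex differentiability in a form that survives pointwise limits: the
   difference quotients are uniformly Cauchy as the increment tends to 0. *)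
Definition regular (h : C -> C) : Prop :=
  forall R0 : R, exists K : R, (0 <= K)%R /\
  forall v : C, (Cmod v <= R0)%R -> (Cmod (h v) <= K)%R /\
  forall t s : C, (Cmod t <= 1)%R -> (Cmod s <= 1)%R ->
  (Cmod (s * (h (v + t) - h v) - t * (h (v + s) - h v))%C
   <= K * (Cmod t * Cmod s * (Cmod t + Cmod s)))%R.

(** Multiplying the expansion for [t] by [s], that for [s] by [t], and subtracting cancels the
    derivative. What is left mentions values of [f] only and can be passed to a pointwise limit. *)
Lemma jet_quotients (f : C -> C) (v : C) (B : R) :
  jet f v B -> (Cmod (f v) <= B)%R /\
  forall t s : C, (Cmod t <= 1)%R -> (Cmod s <= 1)%R ->
  (Cmod (s * (f (v + t) - f v) - t * (f (v + s) - f v))%C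
   <= B * (Cmod t * Cmod s * (Cmod t + Cmod s)))%R.
Proof.
intros (d & K0 & K1 & K2 & H1 & H2 & H3 & H4 & H5).
pose proof (Cmod_ge_0 (f v)) as P1; pose proof (Cmod_ge_0 d) as P2.
split; [lra |]; intros t s Ht Hs.
pose proof (Cmod_ge_0 t) as P3; pose proof (Cmod_ge_0 s) as P4.
replace (s * (f (v + t) - f v) - t * (f (v + s) - f v))
  with (s * (f (v + t) - f v - t * d) + - (t * (f (v + s) - f v - s * d)))
  by ring.
eapply Rle_trans.
{ apply Cmod_plus_le; [| rewrite Cmod_opp]; apply Cmod_mult_le;
    [apply Rle_refl | now apply H4 | apply Rle_refl | now apply H4]. }
replace (Cmod s * (K2 * (Cmod t * Cmod t)) + Cmod t * (K2 * (Cmod s * Cmod s)))%R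
  with (K2 * (Cmod t * Cmod s * (Cmod t + Cmod s)))%R by ring.
apply Rmult_le_compat_r; [| lra].
repeat apply Rmult_le_pos; lra.
Qed.

Lemma regular_limit (u : nat -> C -> C) (h : C -> C) :
  (forall R0 : R, exists B, (0 <= B)%R /\
     forall v n, (Cmod v <= R0)%R -> jet (u n) v B) ->
  (forall v, tends eventually (fun n => u n v) (h v)) ->
  regular h.
Proof.
intros HB Hu R0; destruct (HB R0) as [B [HB0 HB1]]; exists B; split; [exact HB0 |].
intros v Hv; split.
- replace (h v) with (h v - 0) by ring.
  apply (tends_le eventually (fun n => u n v)); [apply Hu |].
  apply filter_forall; intros n.
  replace (u n v - 0) with (u n v) by ring.
  now apply jet_quotients, HB1.
- intros t s Ht Hs.
  rewrite <- (Cminus_0_r (_ - _)).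
  apply (tends_le eventually
    (fun n => s * (u n (v + t) - u n v) - t * (u n (v + s) - u n v))).
  + apply tends_minus; [exact _ | |]; (apply tends_mult;
      [exact _ | apply tends_const; exact _ | apply tends_minus; [exact _ | |]; apply Hu]).
  + apply filter_forall; intros n; rewrite Cminus_0_r.
    now apply jet_quotients; [apply HB1 | |].
Qed.

(** Jacobi's triple product of nome [k] in the variable [Cexp (l * v)], without its constant factor
    [qpoch (k ^ 2) (k ^ 2)] and with a Gaussian in front. The Gaussian is needed to give the theta
    function of -1/tau the multipliers of that of tau. *)
Definition theta_prod (a l k v : C) : C :=
  Cexp (a * v * v) * (qpoch (- k * Cexp (l * v)) (k ^ 2)
                      * qpoch (- k * Cexp (- l * v)) (k ^ 2)).

Lemma Cmod_sqr_lt_1 (k : C) : (Cmod k < 1)%R -> (Cmod (k ^ 2) < 1)%R.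
Proof.
intros H; rewrite Cmod_pow; pose proof (Cmod_ge_0 k); simpl; nra.
Qed.

Lemma theta_prod_regular (a l k : C) :
  (Cmod k < 1)%R -> regular (theta_prod a l k).
Proof.
intros Hk; apply Cmod_sqr_lt_1 in Hk.
apply (regular_limit (fun n v => Cexp (a * v * v)
  * (qprod (- k * Cexp (l * v)) (k ^ 2) n
     * qprod (- k * Cexp (- l * v)) (k ^ 2) n))).
- intros R0.
  assert (J : forall a l, exists B, (0 <= B)%R /\ forall v, (Cmod v <= R0)%R ->
    jet (fun w => Cexp (a * w * w + l * w)) v B)
    by (intros; apply jet_Cexp_quadratic).
  destruct (J a 0) as [B1 [HB1 J1]].
  destruct (J 0 l) as [B2 [HB2 J2]].
  destruct (J 0 (- l)) as [B3 [HB3 J3]].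
  set (b := fun B => exp (Cmod (- k) * B / (1 - Cmod (k ^ 2)))).
  assert (Hb : forall B, (0 <= b B)%R) by (intros; left; apply exp_pos).
  exists (B1 * (b B2 * b B3))%R; split.
  { repeat apply Rmult_le_pos; auto. }
  intros v n Hv.
  apply (jet_mult (fun v => Cexp (a * v * v))).
  { eapply jet_ext; [| now apply J1].
    intros w; cbv beta; f_equal; ring. }
  apply (jet_mult (fun v => qprod (- k * Cexp (l * v)) (k ^ 2) n)).
  + apply (jet_qprod (fun v => Cexp (l * v))); auto.
    eapply jet_ext; [| now apply J2].
    intros w; cbv beta; f_equal; ring.
  + apply (jet_qprod (fun v => Cexp (- l * v))); auto.
    eapply jet_ext; [| now apply J3].
    intros w; cbv beta; f_equal; ring.
- intros v; unfold theta_prod.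
  apply tends_mult; [exact _ | apply tends_const; exact _ |].
  apply tends_mult; [exact _ | |]; now apply qpoch_tends.
Qed.

(** * Uniqueness of theta functions *)

Fixpoint Csum (f : nat -> C) (n : nat) : C :=
  match n with
  | O => 0
  | S m => Csum f m + f m
  end.

Lemma Csum_ext (f g : nat -> C) (n : nat) :
  (forall j, (j < n)%nat -> f j = g j) -> Csum f n = Csum g n.
Proof.
induction n as [| n IH]; intros H; simpl; [reflexivity |].
rewrite IH, H; auto.
Qed.

Lemma Csum_plus (f g : nat -> C) (n : nat) :
  Csum (fun j => f j + g j) n = Csum f n + Csum g n.
Proof.
induction n as [| n IH]; simpl; [ring | rewrite IH; ring].
Qed.

Lemma Csum_mult (c : C) (f : nat -> C) (n : nat) :
  Csum (fun j => c * f j) n = c * Csum f n.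
Proof.
induction n as [| n IH]; simpl; [ring | rewrite IH; ring].
Qed.

Lemma Csum_switch (f : nat -> nat -> C) (m n : nat) :
  Csum (fun i => Csum (f i) n) m = Csum (fun j => Csum (fun i => f i j) m) n.
Proof.
induction m as [| m IH]; simpl.
- induction n as [| n IH]; simpl; [reflexivity | rewrite <- IH; ring].
- rewrite IH, <- Csum_plus; reflexivity.
Qed.

Lemma Csum_add (f : nat -> C) (m n : nat) :
  Csum f (m + n) = Csum f m + Csum (fun j => f (m + j)%nat) n.
Proof.
induction n as [| n IH]; simpl.
- rewrite Nat.add_0_r; ring.
- rewrite Nat.add_succ_r; simpl; rewrite IH; ring.
Qed.

Lemma Cmod_Csum_le (f : nat -> C) (b : R) (n : nat) :
  (forall j, (j < n)%nat -> (Cmod (f j) <= b)%R) ->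
  (Cmod (Csum f n) <= INR n * b)%R.
Proof.
induction n as [| n IH]; intros H.
- simpl; rewrite Cmod_0; lra.
- rewrite S_INR, Rmult_plus_distr_r, Rmult_1_l; simpl Csum.
  apply Cmod_plus_le; auto.
Qed.

Lemma Csum_telescope (f : nat -> C) (n : nat) :
  Csum (fun j => f (S j) - f j) n = f n - f O.
Proof.
induction n as [| n IH]; simpl; [ring | rewrite IH; ring].
Qed.

Lemma Csum_cyclic (f : nat -> C) (n : nat) :
  f n = f O -> Csum (fun j => f (S j)) n = Csum f n.
Proof.
intros H; pose proof (Csum_telescope f n) as E; rewrite H in E.
rewrite (Csum_ext (fun j => f (S j)) (fun j => (f (S j) - f j) + f j))
  by (intros; ring).
rewrite Csum_plus, E; ring.
Qed.

Lemma Csum_single (f : nat -> C) (n : nat) :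
  (0 < n)%nat -> (forall j, (0 < j < n)%nat -> f j = 0) -> Csum f n = f O.
Proof.
induction n as [| n IH]; [lia |]; intros _ H; simpl.
destruct n as [| n]; [simpl; ring |].
rewrite IH, (H (S n)) by (try lia; intros; apply H; lia); ring.
Qed.

Lemma tends_Csum {T : Type} (F : (T -> Prop) -> Prop) {FF : Filter F}
  (f : nat -> T -> C) (l : nat -> C) (n : nat) :
  (forall j, tends F (f j) (l j)) ->
  tends F (fun t => Csum (fun j => f j t) n) (Csum l n).
Proof.
intros H; induction n as [| n IH]; simpl.
- now apply tends_const.
- now apply tends_plus.
Qed.

Lemma Csum_0 (n : nat) : Csum (fun _ => 0) n = 0.
Proof.
induction n as [| n IH]; simpl; [reflexivity | rewrite IH; ring].
Qed.

Lemma Cmod_inv_INR (M : nat) : (0 < M)%nat -> Cmod (/ INR M) = (/ INR M)%R.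
Proof.
intros H; apply lt_0_INR in H.
rewrite <- RtoC_inv by lra.
rewrite Cmod_R, Rabs_pos_eq; [reflexivity |].
left; now apply Rinv_0_lt_compat.
Qed.

Lemma INR_C_neq_0 (M : nat) : (0 < M)%nat -> RtoC (INR M) <> 0.
Proof.
intros H E; apply RtoC_inj in E; apply lt_0_INR in H; lra.
Qed.

(** Up to 1/2 the half-angle formula and the bound on [sin y - y] give the constant 9/32. Beyond 1/2
    the cosine decreases, so the value at 1/2 is a lower bound, while [PI <= 4] keeps the left-hand
    side at most 16/400. *)
Lemma one_sub_cos_lower (phi : R) :
  (Rabs phi <= PI -> phi * phi / 400 <= 1 - cos phi)%R.
Proof.
assert (Hs : forall x, (0 <= x <= 1 / 2 ->
                        x * x * (9 / 32) <= 1 - cos x)%R).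
{ intros x Hx.
  pose proof (cos_2a_sin (x / 2)) as E.
  replace (2 * (x / 2))%R with x in E by field.
  pose proof (Rabs_sin_sub_le (x / 2)) as H.
  apply Rabs_le_between in H.
  assert (x / 2 * (3 / 4) <= sin (x / 2))%R by nra.
  nra. }
assert (Hp : forall x, (0 <= x <= PI -> x * x / 400 <= 1 - cos x)%R).
{ intros x Hx; pose proof PI_4; pose proof PI2_1.
  destruct (Rle_dec x (1 / 2)) as [H1 | H1].
  - specialize (Hs x); nra.
  - specialize (Hs (1 / 2)%R).
    assert (cos x < cos (1 / 2))%R by (apply cos_decreasing_1; lra).
    nra. }
intros H; destruct (Rle_dec 0 phi) as [H1 | H1].
- rewrite Rabs_pos_eq in H by exact H1; apply Hp; lra.
- rewrite Rabs_left in H by lra.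
  rewrite <- cos_neg; specialize (Hp (- phi)%R); lra.
Qed.

(** Multiplication by [z - 1] telescopes the symmetric sum to [z ^ S K - (/ z) ^ K], which vanishes
    for a root of unity of order dividing [2 * K + 1]. Grids are given this odd size so that the
    frequencies from -K to K represent each residue once. *)
Lemma Dirichlet_kernel (z : C) (K : nat) :
  z <> 0 -> z <> 1 -> z ^ (2 * K + 1) = 1 ->
  1 + Csum (fun i => z ^ S i + (/ z) ^ S i) K = 0.
Proof.
intros H0 H1 HK.
assert (E : forall n, (z - 1) * (1 + Csum (fun i => z ^ S i + (/ z) ^ S i) n)
                      = z ^ S n - (/ z) ^ n).
{ induction n as [| n IH].
  - simpl; ring.
  - transitivity ((z - 1) * (1 + Csum (fun i => z ^ S i + (/ z) ^ S i) n)
                  + (z - 1) * (z ^ S n + (/ z) ^ S n)); [simpl; ring |].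
    rewrite IH, !Cpow_S; field; exact H0. }
assert (E2 : z ^ S K = (/ z) ^ K).
{ rewrite Cpow_inv by exact H0.
  replace (2 * K + 1)%nat with (S K + K)%nat in HK by lia.
  rewrite Cpow_add_r in HK.
  rewrite <- (Cmult_1_l (/ z ^ K)), <- HK; field.
  now apply Cpow_nz. }
specialize (E K); rewrite E2 in E.
assert (Hz1 : z - 1 <> 0).
{ intros E3; apply H1; replace z with ((z - 1) + 1) by ring; rewrite E3; ring. }
set (X := 1 + _) in *.
replace X with (/ (z - 1) * ((z - 1) * X)) by (field; exact Hz1).
rewrite E; ring.
Qed.

(** * Finite Fourier analysis of a single theta function *)

Section ThetaSpace.

Variables (tau : C) (h : C -> C).
Hypothesis (Hper : forall v, h (v + 1) = h v).
Hypothesis (Htau : forall v,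
  h (v + tau) = Cexp (- (PI * Ci * tau) - 2 * PI * Ci * v) * h v).
Hypothesis (Hreg : regular h).

(** The general term of the theta series, and at the same time the factor that relates [h v] to [h]
    at [v + k tau]. *)
Definition theta_term (tau : C) (k : Z) (v : C) : C :=
  Cexp (PI * Ci * tau * IZR k * IZR k + 2 * PI * Ci * IZR k * v).

Lemma h_plus_nat_tau (k : nat) (v : C) :
  h (v + IZR (Z.of_nat k) * tau) * theta_term tau (Z.of_nat k) v = h v.
Proof.
unfold theta_term.
induction k as [| k IH].
- simpl; replace (v + 0 * tau) with v by ring.
  replace (PI * Ci * tau * 0 * 0 + 2 * PI * Ci * 0 * v) with (RtoC 0) by ring.
  rewrite Cexp_0; ring.
- rewrite <- IH, Nat2Z.inj_succ, succ_IZR, RtoC_plus.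
  replace (v + (IZR (Z.of_nat k) + 1) * tau)
    with ((v + IZR (Z.of_nat k) * tau) + tau) by ring.
  rewrite Htau, <- Cmult_assoc, (Cmult_comm (h _)), Cmult_assoc, <- Cexp_plus.
  rewrite (Cmult_comm (h _)); f_equal; f_equal; ring.
Qed.

Lemma h_plus_tau (k : Z) (v : C) :
  h v = theta_term tau k v * h (v + IZR k * tau).
Proof.
destruct (Z_le_gt_dec 0 k) as [Hk | Hk].
- rewrite <- (Z2Nat.id k Hk), Cmult_comm, h_plus_nat_tau; reflexivity.
- pose proof (h_plus_nat_tau (Z.to_nat (- k)) (v + IZR k * tau)) as E.
  rewrite Z2Nat.id in E by lia.
  rewrite <- E, opp_IZR, RtoC_opp.
  replace (v + IZR k * tau + - IZR k * tau) with v by ring.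
  unfold theta_term; rewrite opp_IZR, RtoC_opp.
  rewrite (Cmult_comm (h v)), Cmult_assoc, <- Cexp_plus.
  replace (_ + _) with (RtoC 0) by ring.
  rewrite Cexp_0; ring.
Qed.

(** A Riemann sum for the integral of [h] over the period starting at [w]; [freq] is the
    corresponding discrete Fourier coefficient. *)
Definition mean (M : nat) (w : C) : C :=
  / INR M * Csum (fun j => h (w + INR j * / INR M)) M.

Definition freq (M : nat) (k : Z) (v : C) : C :=
  / INR M * Csum (fun j => h (v + INR j * / INR M)
                    * Cexp (- (2 * PI * Ci * IZR k * (INR j * / INR M)))) M.

(** The character in [freq] cancels exactly the part of the automorphy factor of the shift by
    [k tau] that depends on [j]. *)
Lemma freq_mean (M : nat) (k : Z) (v : C) :
  freq M k v = theta_term tau k v * mean M (v + IZR k * tau).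
Proof.
unfold freq, mean.
transitivity (/ INR M * (theta_term tau k v
    * Csum (fun j => h (v + IZR k * tau + INR j * / INR M)) M)); [| ring].
f_equal; rewrite <- Csum_mult; apply Csum_ext; intros j _.
rewrite (h_plus_tau k (v + INR j * / INR M)).
replace (v + IZR k * tau + INR j * / INR M)
  with (v + INR j * / INR M + IZR k * tau) by ring.
rewrite <- Cmult_assoc, (Cmult_comm (h _)), Cmult_assoc; f_equal.
unfold theta_term; rewrite <- Cexp_plus; f_equal; ring.
Qed.

Lemma grid_point (M j : nat) :
  (j < M)%nat -> (Cmod (INR j * / INR M) <= 1)%R.
Proof.
intros H.
assert (HM : (0 < INR M)%R) by (apply lt_0_INR; lia).
rewrite Cmod_mult, Cmod_inv_INR, Cmod_R, Rabs_pos_eq by (lia || apply pos_INR).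
apply Rle_div_l; [exact HM |]; rewrite Rmult_1_l.
apply le_INR; lia.
Qed.

(** A discrete form of Cauchy's theorem. By regularity the difference quotient in direction [t] may
    be replaced, at every grid point, by the one along the grid with step 1/M; the latter sums by
    telescoping over a period to 0. *)
Lemma mean_small_shift (R0 K : R) (M : nat) (w t : C) :
  (0 < M)%nat -> (Cmod t <= 1)%R ->
  (forall v : C, (Cmod v <= R0)%R ->
   forall t s : C, (Cmod t <= 1)%R -> (Cmod s <= 1)%R ->
   (Cmod (s * (h (v + t) - h v) - t * (h (v + s) - h v))%C
    <= K * (Cmod t * Cmod s * (Cmod t + Cmod s)))%R) ->
  (Cmod w + 1 <= R0)%R ->
  (Cmod (mean M (w + t) - mean M w) <= K * Cmod t * (Cmod t + / INR M))%R.
Proof.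
intros HM Ht HK HR.
pose proof (INR_C_neq_0 M HM) as HMC.
assert (HM0 : (0 < INR M)%R) by (now apply lt_0_INR).
set (s := / INR M).
assert (Hs : Cmod s = (/ INR M)%R) by now apply Cmod_inv_INR.
assert (Hs1 : (Cmod s <= 1)%R).
{ rewrite Hs, <- Rinv_1; apply Rinv_le_contravar; [lra |].
  apply (le_INR 1); lia. }
assert (E : mean M (w + t) - mean M w
  = Csum (fun j => s * (h (w + INR j * s + t) - h (w + INR j * s))
                   - t * (h (w + INR j * s + s) - h (w + INR j * s))) M).
{ rewrite (Csum_ext _ (fun j => s * h (w + t + INR j * s)
     + (- s * h (w + INR j * s)
     + - t * (h (w + INR (S j) * s) - h (w + INR j * s))))).
  - rewrite !Csum_plus, !Csum_mult.
    rewrite (Csum_telescope (fun j => h (w + INR j * s))).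
    replace (w + INR M * s) with (w + INR 0 * s + 1)
      by (unfold s; simpl; field; exact HMC).
    rewrite Hper; unfold mean; fold s; ring.
  - intros j _; rewrite S_INR, RtoC_plus.
    replace (w + (INR j + 1) * s) with (w + INR j * s + s) by ring.
    replace (w + t + INR j * s) with (w + INR j * s + t) by ring; ring. }
rewrite E.
eapply Rle_trans.
- apply Cmod_Csum_le; intros j Hj.
  apply HK; [| exact Ht | exact Hs1].
  eapply Rle_trans; [apply Cmod_triangle |].
  pose proof (grid_point M j Hj); unfold s; lra.
- rewrite Hs; right; field; lra.
Qed.

(** The translation is cut into [n] equal steps. The errors of [mean_small_shift] add up to a term
    in 1/M and a term in 1/n, and [n] is arbitrary. *)
Lemma mean_shift (w T : C) :
  exists K, forall M, (0 < M)%nat ->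
  (Cmod (mean M (w + T) - mean M w) <= K * / INR M)%R.
Proof.
destruct (Hreg (Cmod w + Cmod T + 1)%R) as [K [HK0 HK]].
pose proof (Cmod_ge_0 T) as HT.
exists (K * Cmod T)%R; intros M HM.
apply le_epsilon; intros eps Heps.
(* The first summand makes each step at most 1 long, the second makes the 1/n term at most [eps]. *)
destruct (nfloor_ex (Cmod T + K * Cmod T * Cmod T / eps)%R) as [m Hm].
{ apply Rplus_le_le_0_compat; [exact HT |].
  apply Rmult_le_pos; [repeat apply Rmult_le_pos; auto |].
  left; now apply Rinv_0_lt_compat. }
set (n := S m).
assert (Hn : (Cmod T + K * Cmod T * Cmod T / eps <= INR n)%R)
  by (unfold n; rewrite S_INR; lra).
assert (Hn0 : (0 < INR n)%R) by (apply lt_0_INR; unfold n; lia).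
assert (HnC : RtoC (INR n) <> 0) by (apply INR_C_neq_0; unfold n; lia).
assert (Hq : (0 <= K * Cmod T * Cmod T / eps)%R).
{ apply Rmult_le_pos; [repeat apply Rmult_le_pos; auto |].
  left; now apply Rinv_0_lt_compat. }
set (t := T * / INR n).
assert (Ht : Cmod t = (Cmod T / INR n)%R).
{ unfold t; rewrite Cmod_mult, Cmod_inv_INR; [reflexivity | unfold n; lia]. }
assert (Ht1 : (Cmod t <= 1)%R) by (rewrite Ht; apply Rle_div_l; lra).
replace (mean M (w + T) - mean M w)
  with (Csum (fun i => mean M (w + INR (S i) * t) - mean M (w + INR i * t)) n).
2: { rewrite (Csum_telescope (fun i => mean M (w + INR i * t))).
     f_equal; [| f_equal]; f_equal; [unfold t; field; exact HnC | simpl; ring]. }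
eapply Rle_trans.
- apply Cmod_Csum_le; intros i Hi.
  rewrite S_INR, RtoC_plus.
  replace (w + (INR i + 1) * t) with (w + INR i * t + t) by ring.
  apply (mean_small_shift (Cmod w + Cmod T + 1) K); auto.
  + intros v Hv; now apply HK.
  + assert (Cmod (w + INR i * t) <= Cmod w + Cmod T)%R; [| lra].
    apply Cmod_plus_le; [apply Rle_refl |].
    rewrite Cmod_mult, Cmod_R, Rabs_pos_eq, Ht by apply pos_INR.
    replace (INR i * (Cmod T / INR n))%R with (Cmod T * (INR i / INR n))%R
      by (field; lra).
    rewrite <- (Rmult_1_r (Cmod T)) at 2; apply Rmult_le_compat_l; [exact HT |].
    apply Rle_div_l; [exact Hn0 |]; rewrite Rmult_1_l; apply le_INR; lia.
- rewrite Ht.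
  replace (INR n * (K * (Cmod T / INR n) * (Cmod T / INR n + / INR M)))%R
    with (K * Cmod T * / INR M + K * Cmod T * Cmod T / INR n)%R
    by (field; split; [apply Rgt_not_eq, lt_0_INR; exact HM | lra]).
  apply Rplus_le_compat_l, Rle_div_l; [exact Hn0 |].
  assert (H : (K * Cmod T * Cmod T / eps * eps <= INR n * eps)%R)
    by (apply Rmult_le_compat_r; lra).
  replace (K * Cmod T * Cmod T / eps * eps)%R with (K * Cmod T * Cmod T)%R in H
    by (field; lra).
  lra.
Qed.

Lemma tends_mean_sub (w : C) :
  tends eventually (fun K => mean (2 * K + 1) w - mean (2 * K + 1) 0) 0.
Proof.
intros eps Heps.
destruct (mean_shift 0 w) as [K HK].
destruct (nfloor_ex (Rabs K / eps)%R) as [m Hm].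
{ apply Rmult_le_pos; [apply Rabs_pos | left; now apply Rinv_0_lt_compat]. }
exists (S m); intros n Hn.
rewrite Cminus_0_r, <- (Cplus_0_l w).
assert (HM : (0 < 2 * n + 1)%nat) by lia.
eapply Rle_lt_trans; [now apply HK |].
eapply Rle_lt_trans.
{ apply Rmult_le_compat_r; [| apply Rle_abs].
  left; apply Rinv_0_lt_compat, lt_0_INR; lia. }
assert (HM0 : (0 < INR (2 * n + 1))%R) by (apply lt_0_INR; lia).
apply Rlt_div_l; [exact HM0 |].
assert (H1 : (INR m + 1 <= INR (2 * n + 1))%R)
  by (rewrite <- S_INR; apply le_INR; lia).
assert (H2 : (Rabs K / eps * eps < INR (2 * n + 1) * eps)%R)
  by (apply Rmult_lt_compat_r; lra).
replace (Rabs K / eps * eps)%R with (Rabs K) in H2 by (field; lra).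
lra.
Qed.

(** Summation by parts twice: replacing [h] by its second difference along the grid multiplies the
    coefficient by [/ zeta - 2 + zeta], of size about (k/M)^2, while regularity bounds the second
    difference by a multiple of 1/M^2. The restriction on [k] keeps [phi] within [-PI, PI], away
    from aliasing. *)
Lemma freq_decay (v : C) :
  exists K0, (0 <= K0)%R /\ forall (K : nat) (k : Z),
    (0 < Z.abs k <= Z.of_nat K)%Z ->
    (Cmod (freq (2 * K + 1) k v) <= K0 / (IZR k * IZR k))%R.
Proof.
destruct (Hreg (Cmod v + 1)%R) as [K1 [HK1 HK]].
(* The [M] second differences are at most 2 K1/M^2 each, and the multiplier is at least phi^2/200
   with phi^2 at least 4 k^2/M^2. *)
exists (100 * K1)%R; split; [lra |]; intros K k Hk.
set (M := (2 * K + 1)%nat).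
assert (HM : (0 < M)%nat) by (unfold M; lia).
assert (HM0 : (0 < INR M)%R) by now apply lt_0_INR.
pose proof (INR_C_neq_0 M HM) as HMC.
assert (Hk0 : (1 <= IZR k * IZR k)%R).
{ rewrite <- mult_IZR; apply IZR_le; nia. }
set (s := / INR M).
assert (Hs : Cmod s = (/ INR M)%R) by now apply Cmod_inv_INR.
assert (Hs1 : (Cmod s <= 1)%R).
{ rewrite Hs, <- Rinv_1; apply Rinv_le_contravar; [lra |].
  apply (le_INR 1); lia. }
set (phi := (2 * PI * IZR k / INR M)%R).
set (zeta := Cexp (- (Ci * phi))).
assert (Hz : forall j, Cexp (- (2 * PI * Ci * IZR k * (INR j * s)))
                       = zeta ^ j).
{ intros j; unfold zeta; rewrite Cexp_pow; f_equal.
  unfold phi, s; rewrite RtoC_div, !RtoC_mult by lra; field; exact HMC. }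
assert (HzM : zeta ^ M = 1).
{ rewrite <- Hz, <- (Cexp_2PI (- k)); f_equal.
  unfold s; rewrite opp_IZR, RtoC_opp; field; exact HMC. }
assert (Hz0 : zeta <> 0) by apply Cexp_neq_0.
set (S0 := Csum (fun j => h (v + INR j * s) * zeta ^ j) M).
assert (EF : freq M k v = s * S0).
{ unfold freq; fold s; f_equal; apply Csum_ext; intros j _; now rewrite Hz. }
assert (EM : INR M * s = 1) by (unfold s; field; exact HMC).
assert (E1 : Csum (fun j => h (v + INR (S j) * s) * zeta ^ j) M = / zeta * S0).
{ unfold S0.
  rewrite <- (Csum_cyclic (fun j => h (v + INR j * s) * zeta ^ j)).
  - rewrite <- Csum_mult; apply Csum_ext; intros j _; rewrite Cpow_S.
    field; exact Hz0.
  - rewrite HzM, EM, Hper; change (INR 0) with 0%R.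
    replace (v + 0 * s) with v by ring; reflexivity. }
assert (E2 : Csum (fun j => h (v + INR j * s - s) * zeta ^ j) M = zeta * S0).
{ unfold S0.
  rewrite <- (Csum_cyclic (fun j => h (v + INR j * s - s) * zeta ^ j)).
  - rewrite <- Csum_mult; apply Csum_ext; intros j _; rewrite Cpow_S.
    rewrite S_INR, RtoC_plus.
    replace (v + (INR j + 1) * s - s) with (v + INR j * s) by ring; ring.
  - rewrite HzM, EM; replace (v + 1 - s) with (v - s + 1) by ring.
    rewrite Hper; change (INR 0) with 0%R.
    replace (v + 0 * s - s) with (v - s) by ring; reflexivity. }
assert (E3 : (/ zeta - 2 + zeta) * S0
  = Csum (fun j => (h (v + INR j * s + s) - h (v + INR j * s)
                    + (h (v + INR j * s + - s) - h (v + INR j * s)))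
                   * zeta ^ j) M).
{ rewrite (Csum_ext _ (fun j => h (v + INR (S j) * s) * zeta ^ j
    + (h (v + INR j * s - s) * zeta ^ j
       + - 2 * (h (v + INR j * s) * zeta ^ j)))).
  - rewrite !Csum_plus, Csum_mult, E1, E2; fold S0; ring.
  - intros j _; rewrite S_INR, RtoC_plus.
    replace (v + (INR j + 1) * s) with (v + INR j * s + s) by ring.
    unfold Cminus; ring. }
assert (B3 : (Cmod ((/ zeta - 2 + zeta) * S0)
              <= INR M * (2 * K1 * (Cmod s * Cmod s)))%R).
{ rewrite E3; apply Cmod_Csum_le; intros j Hj.
  assert (Hzj : Cmod (zeta ^ j) = 1%R).
  { rewrite Cmod_pow; unfold zeta; rewrite Cmod_Cexp; simpl.
    replace (- (0 * phi - 1 * 0))%R with 0%R by ring.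
    rewrite exp_0; apply pow1. }
  rewrite Cmod_mult, Hzj, Rmult_1_r.
  assert (Hv : (Cmod (v + INR j * s) <= Cmod v + 1)%R)
    by (apply Cmod_plus_le; [lra | now apply grid_point]).
  destruct (HK _ Hv) as [_ HK2].
  assert (Hs2 : (Cmod (- s) <= 1)%R) by now rewrite Cmod_opp.
  (* With increments [s] and [- s] the comparison of difference quotients becomes the second
     difference, multiplied by [s]. *)
  specialize (HK2 s (- s) Hs1 Hs2); rewrite Cmod_opp in HK2.
  set (X := h (v + INR j * s + s) - h (v + INR j * s)) in *.
  set (Y := h (v + INR j * s + - s) - h (v + INR j * s)) in *.
  replace (- s * X - s * Y) with (- (s * (X + Y))) in HK2 by ring.
  rewrite Cmod_opp, Cmod_mult in HK2.
  assert (Hsp : (0 < Cmod s)%R) by (rewrite Hs; now apply Rinv_0_lt_compat).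
  apply (Rmult_le_reg_l (Cmod s)); [exact Hsp |].
  eapply Rle_trans; [exact HK2 | right; ring]. }
assert (Hzz : / zeta - 2 + zeta = RtoC (2 * cos phi - 2)).
{ unfold zeta; rewrite <- Cexp_opp.
  replace (- - (Ci * phi)) with (Ci * phi) by ring.
  unfold Cexp; apply injective_projections; simpl.
  - replace (0 * phi - 1 * 0)%R with 0%R by ring.
    replace (0 * 0 + 1 * phi)%R with phi by ring.
    rewrite Ropp_0, exp_0, cos_neg; ring.
  - replace (0 * phi - 1 * 0)%R with 0%R by ring.
    replace (0 * 0 + 1 * phi)%R with phi by ring.
    rewrite Ropp_0, exp_0, sin_neg; ring. }
rewrite Cmod_mult, Hzz, Cmod_R in B3.
assert (Hphi : (Rabs phi <= PI)%R).
{ pose proof PI_RGT_0.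
  unfold phi; rewrite Rabs_div, Rabs_mult, (Rabs_pos_eq (INR M)) by lra.
  rewrite (Rabs_pos_eq (2 * PI)) by lra.
  apply Rle_div_l; [exact HM0 |].
  rewrite <- abs_IZR.
  assert (2 * IZR (Z.abs k) <= INR M)%R; [| nra].
  rewrite INR_IZR_INZ, <- mult_IZR; apply IZR_le; unfold M; lia. }
apply one_sub_cos_lower in Hphi.
assert (Hphi2 : (phi * phi = 4 * (PI * PI) * (IZR k * IZR k) / (INR M * INR M))%R)
  by (unfold phi; field; lra).
set (w := (/ INR M)%R) in *.
assert (Hw : (0 < w)%R) by now apply Rinv_0_lt_compat.
assert (Hphi3 : (4 * (IZR k * IZR k) * (w * w) <= phi * phi)%R).
{ rewrite Hphi2; pose proof PI2_1.
  replace (4 * (PI * PI) * (IZR k * IZR k) / (INR M * INR M))%R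
    with (PI * PI * (4 * (IZR k * IZR k) * (w * w)))%R
    by (unfold w; field; lra).
  assert (0 <= 4 * (IZR k * IZR k) * (w * w))%R
    by (apply Rmult_le_pos; [lra | apply Rmult_le_pos; lra]).
  assert (1 <= PI * PI)%R by nra.
  nra. }
rewrite EF, Cmod_mult, Hs.
rewrite Hs in B3.
assert (Habs : (2 * (phi * phi / 400) <= Rabs (2 * cos phi - 2))%R).
{ rewrite <- Rabs_Ropp, Rabs_pos_eq; pose proof (COS_bound phi); lra. }
pose proof (Cmod_ge_0 S0) as HS0.
assert (B4 : (4 * (IZR k * IZR k) * (w * w) / 200 * Cmod S0
              <= INR M * (2 * K1 * (w * w)))%R).
{ eapply Rle_trans; [| exact B3].
  apply Rmult_le_compat_r; [exact HS0 | lra]. }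
apply (Rle_div_r _ _ (IZR k * IZR k)); [lra |].
assert (HMw : (INR M * w = 1)%R) by (unfold w; field; lra).
apply (Rmult_le_reg_r (w / 50)); [lra |].
replace (w * Cmod S0 * (IZR k * IZR k) * (w / 50))%R
  with (4 * (IZR k * IZR k) * (w * w) / 200 * Cmod S0)%R by field.
eapply Rle_trans; [exact B4 |].
replace (INR M * (2 * K1 * (w * w)))%R with (2 * K1 * w * (INR M * w))%R by ring.
rewrite HMw; lra.
Qed.

(** Exchanging the sums puts a Dirichlet kernel at every grid point. It vanishes except at [j = 0],
    where it equals the grid size and cancels the normalisation. *)
Lemma freq_inversion (K : nat) (v : C) :
  h v = freq (2 * K + 1) 0 v
        + Csum (fun i => freq (2 * K + 1) (Z.of_nat (S i)) v
                         + freq (2 * K + 1) (- Z.of_nat (S i)) v) K.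
Proof.
set (M := (2 * K + 1)%nat).
assert (HM : (0 < M)%nat) by (unfold M; lia).
pose proof (INR_C_neq_0 M HM) as HMC.
set (z := fun j : nat => Cexp (- (2 * PI * Ci * (INR j * / INR M)))).
assert (Hz0 : forall j, z j <> 0) by (intros; apply Cexp_neq_0).
assert (HF0 : freq M 0 v = / INR M * Csum (fun j => h (v + INR j * / INR M)) M).
{ unfold freq; f_equal; apply Csum_ext; intros j _.
  replace (- (2 * PI * Ci * 0 * (INR j * / INR M))) with (RtoC 0) by ring.
  rewrite Cexp_0; ring. }
assert (HFp : forall i, freq M (Z.of_nat i) v
  = / INR M * Csum (fun j => h (v + INR j * / INR M) * z j ^ i) M).
{ intros i; unfold freq; f_equal; apply Csum_ext; intros j _; f_equal.
  unfold z; rewrite Cexp_pow, <- INR_IZR_INZ; f_equal; ring. }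
assert (HFm : forall i, freq M (- Z.of_nat i) v
  = / INR M * Csum (fun j => h (v + INR j * / INR M) * (/ z j) ^ i) M).
{ intros i; unfold freq; f_equal; apply Csum_ext; intros j _; f_equal.
  unfold z; rewrite <- Cexp_opp, Cexp_pow, opp_IZR, <- INR_IZR_INZ, RtoC_opp.
  f_equal; ring. }
rewrite HF0.
rewrite (Csum_ext (fun i => freq M (Z.of_nat (S i)) v
                            + freq M (- Z.of_nat (S i)) v)
                  (fun i => / INR M * Csum (fun j => h (v + INR j * / INR M)
          * (z j ^ S i + (/ z j) ^ S i)) M)).
2: { intros i _; cbv beta; rewrite HFp, HFm, <- Cmult_plus_distr_l, <- Csum_plus.
     f_equal; apply Csum_ext; intros j _; ring. }
rewrite Csum_mult, Csum_switch, <- Cmult_plus_distr_l, <- Csum_plus.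
rewrite (Csum_ext _ (fun j => h (v + INR j * / INR M)
          * (1 + Csum (fun i => z j ^ S i + (/ z j) ^ S i) K))).
2: { intros j _; cbv beta; rewrite Csum_mult; ring. }
rewrite Csum_single; [| exact HM |].
- assert (Hz : z O = 1).
  { unfold z; replace (- _) with (RtoC 0) by (simpl; ring); apply Cexp_0. }
  rewrite Hz.
  assert (HK : forall n, Csum (fun i => 1 ^ S i + (/ 1) ^ S i) n = 2 * INR n).
  { induction n as [| n IH]; [simpl; ring |].
    transitivity (2 * INR n + (1 ^ S n + (/ 1) ^ S n)); [now rewrite <- IH |].
    rewrite Cpow_inv, !Cpow_1_l, S_INR, RtoC_plus by exact C1_nz; field. }
  rewrite HK.
  replace (v + INR 0 * / INR M) with v by (simpl; ring).
  replace (1 + 2 * INR K) with (RtoC (INR M)).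
  + field; exact HMC.
  + unfold M; rewrite plus_INR, mult_INR, RtoC_plus, RtoC_mult.
    change (INR 1) with 1%R; change (INR 2) with 2%R; ring.
- intros j Hj; rewrite Dirichlet_kernel; [ring | apply Hz0 | |].
  + intros E; apply Cexp_eq_1 in E; destruct E as [k Hk].
    assert (E : RtoC (IZR (Z.of_nat j + k * Z.of_nat M)) = 0).
    { rewrite plus_IZR, mult_IZR, <- !INR_IZR_INZ, RtoC_plus, RtoC_mult.
      assert (HP : 2 * PI * Ci <> 0).
      { apply Cmult_neq_0; [apply Cmult_neq_0 |]; intros E.
        - apply RtoC_inj in E; lra.
        - apply RtoC_inj in E; pose proof PI_RGT_0; lra.
        - injection E; lra. }
      replace (INR j + IZR k * INR M)
        with (INR M * / (2 * PI * Ci)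
              * (2 * PI * Ci * IZR k - - (2 * PI * Ci * (INR j * / INR M))))
        by (field; repeat split; auto;
            intros E; apply HP; rewrite E; ring).
      rewrite Hk; ring. }
    apply RtoC_inj, eq_IZR in E; clear - E Hj; clearbody M.
    destruct (Z_le_gt_dec 0 k).
    * assert (0 <= k * Z.of_nat M)%Z by nia; lia.
    * assert (k * Z.of_nat M <= - 1 * Z.of_nat M)%Z
        by (apply Z.mul_le_mono_nonneg_r; lia).
      lia.
  + fold M; unfold z; rewrite Cexp_pow, <- (Cexp_2PI (- Z.of_nat j)).
    rewrite opp_IZR, <- INR_IZR_INZ, RtoC_opp; f_equal; field; exact HMC.
Qed.

(** Inverse squares are dominated by the telescoping differences of inverses; the sum is thus below
    [c / INR n] however many terms it has. *)
Lemma Cmod_Csum_inv_squares (f : nat -> C) (c : R) (n p : nat) :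
  (0 <= c)%R -> (0 < n)%nat ->
  (forall i, (i < p)%nat -> (Cmod (f i) <= c / (INR (S (n + i)) * INR (S (n + i))))%R) ->
  (Cmod (Csum f p) <= c * (/ INR n - / INR (n + p)))%R.
Proof.
intros Hc Hn; induction p as [| p IH]; intros H.
- rewrite Nat.add_0_r; simpl; rewrite Cmod_0; lra.
- simpl Csum; eapply Rle_trans.
  { apply Cmod_plus_le; [apply IH; auto | apply H; lia]. }
  assert (Hp : (0 < INR (n + p))%R) by (apply lt_0_INR; lia).
  rewrite Nat.add_succ_r, S_INR.
  set (y := INR (n + p)) in *.
  assert (/ ((y + 1) * (y + 1)) <= / y - / (y + 1))%R.
  { replace (/ y - / (y + 1))%R with (/ (y * (y + 1)))%R by (field; lra).
    apply Rinv_le_contravar; nra. }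
  unfold Rdiv; nra.
Qed.

Definition theta_sum (n : nat) (v : C) : C :=
  1 + Csum (fun i => theta_term tau (Z.of_nat (S i)) v
                     + theta_term tau (- Z.of_nat (S i)) v) n.

(** The approximant is a product of a factor depending on [h] but not on [v] and a factor depending
    on [v] but not on [h]. Frequencies above [n] cost B/n by [freq_decay], uniformly in the grid;
    the finitely many others have their means replaced by the mean at 0 as the grid is refined. *)
Lemma theta_approx (v : C) :
  exists B, (0 <= B)%R /\ forall n, (0 < n)%nat ->
  forall eps, (0 < eps)%R -> eventually (fun K =>
    (Cmod (h v - mean (2 * K + 1) 0 * theta_sum n v) <= B * / INR n + eps)%R).
Proof.
destruct (freq_decay v) as [K0 [HK0 HK]].
exists (2 * K0)%R; split; [lra |]; intros n Hn eps Heps.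
(* The error made at the frequencies from -n to n by moving every mean to the point 0. *)
set (A := fun K : nat => let M := (2 * K + 1)%nat in
  (freq M 0 v - theta_term tau 0 v * mean M 0)
  + Csum (fun i =>
      (freq M (Z.of_nat (S i)) v - theta_term tau (Z.of_nat (S i)) v * mean M 0)
    + (freq M (- Z.of_nat (S i)) v
       - theta_term tau (- Z.of_nat (S i)) v * mean M 0)) n).
assert (HA : tends eventually A 0).
{ assert (Hk : forall k, tends eventually (fun K => freq (2 * K + 1) k v
      - theta_term tau k v * mean (2 * K + 1) 0) 0).
  { intros k.
    pose proof (tends_mult eventually _ _ _ _
      (tends_const eventually (theta_term tau k v))
      (tends_mean_sub (v + IZR k * tau))) as E.
    rewrite Cmult_0_r in E; refine (tends_ext eventually _ _ _ _ E); apply filter_forall.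
    intros K; rewrite freq_mean; ring. }
  replace (RtoC 0) with (0 + Csum (fun _ => 0 + 0) n).
  2: { rewrite (Csum_ext _ (fun _ => 0)) by (intros; ring).
       rewrite Csum_0; ring. }
  apply tends_plus; [exact _ | apply Hk |].
  apply (tends_Csum eventually (fun i K =>
      (freq (2 * K + 1) (Z.of_nat (S i)) v
       - theta_term tau (Z.of_nat (S i)) v * mean (2 * K + 1) 0)
    + (freq (2 * K + 1) (- Z.of_nat (S i)) v
       - theta_term tau (- Z.of_nat (S i)) v * mean (2 * K + 1) 0))).
  intros i; apply tends_plus; [exact _ | |]; apply Hk. }
assert (HE : eventually (fun K => (n <= K)%nat)) by (now exists n).
generalize (filter_and _ _ HE (HA eps Heps)); apply filter_imp.
intros K [HnK HAK]; rewrite Cminus_0_r in HAK.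
replace (h v - mean (2 * K + 1) 0 * theta_sum n v) with
  (Csum (fun i => freq (2 * K + 1) (Z.of_nat (S (n + i))) v
                  + freq (2 * K + 1) (- Z.of_nat (S (n + i))) v) (K - n) + A K).
- apply Cmod_plus_le; [| lra].
  eapply Rle_trans.
  + apply (Cmod_Csum_inv_squares _ (2 * K0)); [lra | exact Hn |].
    intros i Hi.
    replace (2 * K0 / (INR (S (n + i)) * INR (S (n + i))))%R
      with (K0 / (INR (S (n + i)) * INR (S (n + i)))
            + K0 / (INR (S (n + i)) * INR (S (n + i))))%R
      by (field; apply not_0_INR; lia).
    apply Cmod_plus_le.
    * rewrite INR_IZR_INZ; apply HK; lia.
    * replace (INR (S (n + i)) * INR (S (n + i)))%R
        with (IZR (- Z.of_nat (S (n + i))) * IZR (- Z.of_nat (S (n + i))))%R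
        by (rewrite opp_IZR, <- INR_IZR_INZ; ring).
      apply HK; lia.
  + apply Rmult_le_compat_l; [lra |].
    assert (0 < / INR (n + (K - n)))%R
      by (apply Rinv_0_lt_compat, lt_0_INR; lia).
    lra.
- rewrite (freq_inversion K v) at 1.
  replace K with (n + (K - n))%nat at 4 by lia.
  rewrite Csum_add; unfold A, theta_sum; cbv zeta.
  assert (EA : Csum (fun i =>
      (freq (2 * K + 1) (Z.of_nat (S i)) v
       - theta_term tau (Z.of_nat (S i)) v * mean (2 * K + 1) 0)
    + (freq (2 * K + 1) (- Z.of_nat (S i)) v
       - theta_term tau (- Z.of_nat (S i)) v * mean (2 * K + 1) 0)) n
    = Csum (fun i => freq (2 * K + 1) (Z.of_nat (S i)) v
                     + freq (2 * K + 1) (- Z.of_nat (S i)) v) n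
      + - mean (2 * K + 1) 0
        * Csum (fun i => theta_term tau (Z.of_nat (S i)) v
                         + theta_term tau (- Z.of_nat (S i)) v) n).
  { rewrite <- Csum_mult, <- Csum_plus; apply Csum_ext; intros i _; ring. }
  rewrite EA.
  assert (E0 : theta_term tau 0 v = 1).
  { unfold theta_term; rewrite <- Cexp_0; f_equal; ring. }
  rewrite E0; ring.
Qed.

End ThetaSpace.

(* Fourier expansion on the grid [v + Z/M]: quasi-periodicity turns the k-th
   coefficient into [theta_term tau k v] times a mean of [h] over a translated
   period, and these means become independent of the translation as M grows.
   So every [h] is proportional to the same theta series. *)
Lemma theta_space_dim_1 (tau : C) (f g : C -> C) :
  (forall v, f (v + 1) = f v) -> (forall v, g (v + 1) = g v) ->
  (forall v, f (v + tau) = Cexp (- (PI * Ci * tau) - 2 * PI * Ci * v) * f v) ->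
  (forall v, g (v + tau) = Cexp (- (PI * Ci * tau) - 2 * PI * Ci * v) * g v) ->
  regular f -> regular g ->
  forall u v, f u * g v = f v * g u.
Proof.
intros Hf1 Hg1 Hft Hgt Hfr Hgr u v.
destruct (theta_approx tau f Hf1 Hft Hfr u) as [B1 [P1 A1]].
destruct (theta_approx tau f Hf1 Hft Hfr v) as [B2 [P2 A2]].
destruct (theta_approx tau g Hg1 Hgt Hgr u) as [B3 [P3 A3]].
destruct (theta_approx tau g Hg1 Hgt Hgr v) as [B4 [P4 A4]].
set (H := (Cmod (f u) + Cmod (f v) + Cmod (g u) + Cmod (g v))%R).
pose proof (Cmod_ge_0 (f u)); pose proof (Cmod_ge_0 (f v)).
pose proof (Cmod_ge_0 (g u)); pose proof (Cmod_ge_0 (g v)).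
assert (HH : (0 <= H)%R) by (unfold H; lra).
(* Up to [eps] the two by two matrix of values of [f] and [g] at [u] and [v] has rank one, so its
   determinant is of order [eps]. All four estimates hold eventually, hence for a common grid. *)
assert (S : forall eps, (0 < eps <= 1)%R ->
  exists a b s t : C, (Cmod (f u - a * s) <= eps /\ Cmod (f v - a * t) <= eps /\
                       Cmod (g u - b * s) <= eps /\ Cmod (g v - b * t) <= eps)%R).
{ intros eps Heps.
  set (B := (B1 + B2 + B3 + B4)%R).
  destruct (nfloor_ex (2 * B / eps)%R) as [m Hm].
  { apply Rmult_le_pos; [unfold B; lra | left; apply Rinv_0_lt_compat; lra]. }
  set (n := S m).
  assert (Hn : (0 < n)%nat) by (unfold n; lia).
  assert (Hn0 : (0 < INR n)%R) by now apply lt_0_INR.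
  assert (HB : (B * / INR n <= eps / 2)%R).
  { apply Rle_div_l; [exact Hn0 |].
    assert (2 * B / eps * eps <= INR n * eps)%R
      by (apply Rmult_le_compat_r; unfold n; rewrite ?S_INR; lra).
    replace (2 * B / eps * eps)%R with (2 * B)%R in * by (field; lra).
    lra. }
  assert (He : (0 < eps / 2)%R) by lra.
  destruct (filter_ex _ (filter_and _ _
      (filter_and _ _ (A1 n Hn _ He) (A2 n Hn _ He))
      (filter_and _ _ (A3 n Hn _ He) (A4 n Hn _ He))))
    as [K [[E1 E2] [E3 E4]]].
  exists (mean f (2 * K + 1) 0), (mean g (2 * K + 1) 0),
    (theta_sum tau n u), (theta_sum tau n v).
  assert (Q : forall x, (0 <= x <= B -> x * / INR n + eps / 2 <= eps)%R).
  { intros x Hx.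
    assert (x * / INR n <= B * / INR n)%R; [| lra].
    apply Rmult_le_compat_r; [left; now apply Rinv_0_lt_compat | lra]. }
  repeat split; (eapply Rle_trans; [eassumption | apply Q; unfold B; lra]). }
assert (Z : (Cmod (f u * g v - f v * g u) <= 0)%R).
{ apply le_epsilon; intros eta Heta.
  (* The determinant is at most [2 * (eps * H + (H + eps) * eps)], which is at most [c * eps] when
     [eps <= 1]. *)
  set (c := (4 * H + 2)%R).
  set (eps := Rmin 1 (eta / c)).
  assert (Hc : (0 < c)%R) by (unfold c; lra).
  assert (He : (0 < eps)%R)
    by (apply Rmin_pos; [lra | now apply Rdiv_lt_0_compat]).
  assert (He1 : (eps <= 1)%R) by apply Rmin_l.
  assert (Hec : (eps * c <= eta)%R).
  { replace eta with (eta / c * c)%R by (field; lra).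
    apply Rmult_le_compat_r; [lra | apply Rmin_r]. }
  destruct (S eps (conj He He1)) as (a & b & s & t & E1 & E2 & E3 & E4).
  replace (f u * g v - f v * g u) with
    ((f u - a * s) * g v + (f u + - (f u - a * s)) * (g v - b * t)
     + - ((f v - a * t) * g u + (f v + - (f v - a * t)) * (g u - b * s)))
    by ring.
  assert (G : forall x y p q, (Cmod x <= H -> Cmod y <= H -> Cmod p <= eps ->
    Cmod q <= eps -> Cmod (p * y + (x + - p) * q)%C
                     <= eps * H + (H + eps) * eps)%R).
  { intros x y p q Hx Hy Hp Hq.
    apply Cmod_plus_le; apply Cmod_mult_le; auto.
    apply Cmod_plus_le; [exact Hx | now rewrite Cmod_opp]. }
  eapply Rle_trans.
  { apply Cmod_plus_le; [| rewrite Cmod_opp]; apply G; try eassumption;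
      unfold H; lra. }
  unfold c in Hec; nra. }
assert (Z0 : f u * g v - f v * g u = 0)
  by (apply Cmod_eq_0, Rle_antisym; [exact Z | apply Cmod_ge_0]).
replace (f u * g v) with ((f u * g v - f v * g u) + f v * g u) by ring.
rewrite Z0; ring.
Qed.

(** * Modular transformation of theta products *)

Lemma theta_prod_opp (a l k v : C) :
  theta_prod a (- l) k v = theta_prod a l k v.
Proof.
unfold theta_prod; replace (- - l * v) with (l * v) by ring; ring.
Qed.

Lemma theta_prod_period (a l k v t : C) :
  Cexp (l * t) = 1 ->
  theta_prod a l k (v + t) = Cexp (a * t * (2 * v + t)) * theta_prod a l k v.
Proof.
intros Ht; unfold theta_prod.
replace (l * (v + t)) with (l * v + l * t) by ring.
replace (- l * (v + t)) with (- l * v + - (l * t)) by ring.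
replace (a * (v + t) * (v + t)) with (a * t * (2 * v + t) + a * v * v) by ring.
rewrite !Cexp_plus, Cexp_opp, Ht.
replace (Cexp (- l * v) * / 1) with (Cexp (- l * v)) by (field; exact C1_nz).
rewrite Cmult_1_r; ring.
Qed.

(** With y for [Cexp (l * v)], the shift removes the factor 1 + k y from one product and adds 1 +
    1/(k y) to the other; their quotient is 1/(k y). *)
Lemma theta_prod_quasi_period (a l k v t : C) :
  (Cmod k < 1)%R -> k <> 0 -> Cexp (l * t) = k ^ 2 ->
  theta_prod a l k (v + t)
  = Cexp (a * t * (2 * v + t)) * / (k * Cexp (l * v)) * theta_prod a l k v.
Proof.
intros Hk Hk0 Ht; unfold theta_prod.
assert (Hk2 := Cmod_sqr_lt_1 k Hk).
pose proof (Cexp_neq_0 (l * v)) as Hy.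
replace (l * (v + t)) with (l * v + l * t) by ring.
replace (- l * (v + t)) with (- (l * v + l * t)) by ring.
replace (- l * v) with (- (l * v)) by ring.
replace (a * (v + t) * (v + t)) with (a * t * (2 * v + t) + a * v * v) by ring.
rewrite !Cexp_opp, !Cexp_plus, Ht.
set (y := Cexp (l * v)) in *.
rewrite (qpoch_step (- k * y) (k ^ 2) Hk2).
rewrite (qpoch_step (- k * / (y * k ^ 2)) (k ^ 2) Hk2).
replace (- k * (y * k ^ 2)) with (- k * y * k ^ 2) by ring.
replace (- k * / (y * k ^ 2) * k ^ 2) with (- k * / y) by (field; auto).
field; auto.
Qed.

(** The products over odd powers 1 + k^(2j-1), odd powers 1 - k^(2j-1) and even powers 1 + k^(2j),
    numbered after Jacobi's theta constants in which their squares occur. *)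
Definition euler3 (k : C) : C := qpoch (- k) (k ^ 2).
Definition euler4 (k : C) : C := qpoch k (k ^ 2).
Definition euler2 (k : C) : C := qpoch (- k ^ 2) (k ^ 2).

(** After multiplication by [qpoch Q Q] the identity is finite: the factors with [Q] and [- Q] give
    1 - Q^(2j), those with [k] and [- k] give 1 - Q^(2j-1), and together they form the partial
    product of length 2n. *)
Lemma euler_product (k : C) :
  (Cmod k < 1)%R -> euler2 k * euler3 k * euler4 k = 1.
Proof.
intros Hk; assert (Hk2 := Cmod_sqr_lt_1 k Hk).
set (Q := k ^ 2) in *.
assert (HB : qpoch Q Q <> 0).
{ apply qpoch_neq_0; [exact Hk2 |]; intros j E.
  assert (E1 : Cmod (Q * Q ^ j) = 1%R) by (rewrite E; apply Cmod_1).
  rewrite Cmod_mult, Cmod_pow in E1.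
  pose proof (Cmod_ge_0 Q).
  assert (Cmod Q ^ j <= 1)%R by (rewrite <- (pow1 j); apply pow_incr; lra).
  assert (0 <= Cmod Q ^ j)%R by (apply pow_le; lra).
  nra. }
assert (E : euler2 k * euler3 k * euler4 k * qpoch Q Q = qpoch Q Q).
{ apply (tends_unique eventually (fun n => qprod Q Q (2 * n))).
  - apply (tends_ext _ (fun n => qprod (- Q) Q n * qprod (- k) Q n * qprod k Q n
                               * qprod Q Q n)).
    + apply filter_forall; induction x as [| n IH].
      * unfold qprod; simpl; ring.
      * replace (2 * S n)%nat with (S (S (2 * n))) by lia.
        transitivity (qprod Q Q (2 * n) * (1 - Q * Q ^ (2 * n))
                      * (1 - Q * Q ^ (S (2 * n)))); [| reflexivity].
        rewrite <- IH; unfold qprod; simpl Cprod; rewrite !Cpow_S.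
        replace (2 * n)%nat with (n + n)%nat by lia.
        rewrite Cpow_add_r.
        assert (HQ : Q = k * k) by (unfold Q; ring).
        rewrite HQ; ring.
    + unfold euler2, euler3, euler4; fold Q.
      repeat (apply tends_mult; [exact _ | | now apply qpoch_tends]).
      now apply qpoch_tends.
  - apply (tends_shift (qprod Q Q) _ (fun n => (2 * n)%nat)); [lia |].
    now apply qpoch_tends. }
replace (euler2 k * euler3 k * euler4 k)
  with (euler2 k * euler3 k * euler4 k * qpoch Q Q * / qpoch Q Q)
  by (field; exact HB).
rewrite E; field; exact HB.
Qed.

(** * The theta products of tau and of -1/tau, and their ratio *)

Section Modular.

Variable tau : C.
Hypothesis (Htau : (0 < Im tau)%R).

Definition nome (tau : C) : C := Cexp (PI * Ci * tau).
Definition nome' (tau : C) : C := Cexp (- (PI * Ci * / tau)).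

Lemma tau_neq_0 : tau <> 0.
Proof.
intros E; rewrite E in Htau; simpl in Htau; lra.
Qed.

Lemma nome_lt_1 : (Cmod (nome tau) < 1)%R.
Proof.
unfold nome; rewrite Cmod_Cexp, <- exp_0; apply exp_increasing.
destruct tau as [a b]; simpl in *; pose proof PI_RGT_0; nra.
Qed.

Lemma nome'_lt_1 : (Cmod (nome' tau) < 1)%R.
Proof.
unfold nome'; rewrite Cmod_Cexp, <- exp_0; apply exp_increasing.
destruct tau as [a b]; simpl in *; pose proof PI_RGT_0.
assert (Hd : (0 < a ^ 2 + b ^ 2)%R) by nra.
assert (0 < b / (a * (a * 1) + b * (b * 1)))%R
  by (apply Rdiv_lt_0_compat; simpl in Hd; lra).
replace (- b / (a * (a * 1) + b * (b * 1)))%R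
  with (- (b / (a * (a * 1) + b * (b * 1))))%R by (field; simpl in Hd; lra).
nra.
Qed.

Definition theta_1 : C -> C := theta_prod 0 (2 * PI * Ci) (nome tau).
Definition theta_2 : C -> C :=
  theta_prod (- (PI * Ci * / tau)) (2 * PI * Ci * / tau) (nome' tau).

(** The two functions exchange the roles of the lattice generators: 1 leaves the exponentials of
    [theta_1] unchanged and shifts the products of [theta_2], and [tau] does the reverse. The
    Gaussian of [theta_2] makes the multipliers agree. *)
Lemma theta_1_theta_2 (u v : C) : theta_1 u * theta_2 v = theta_1 v * theta_2 u.
Proof.
pose proof tau_neq_0 as H0.
assert (P : Cexp (2 * PI * Ci * 1) = 1).
{ exact (Cexp_2PI 1). }
apply (theta_space_dim_1 tau); clear u v.
- intros v; unfold theta_1; rewrite theta_prod_period by exact P.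
  replace (0 * 1 * (2 * v + 1)) with (RtoC 0) by ring.
  rewrite Cexp_0; ring.
- intros v; unfold theta_2.
  (* The shift by 1 multiplies the exponential by the inverse square of [nome' tau]; with [l]
     reversed it is the square that the quasi-period lemma expects. *)
  rewrite <- !(theta_prod_opp _ (2 * PI * Ci * / tau)).
  rewrite theta_prod_quasi_period; [| apply nome'_lt_1 | apply Cexp_neq_0 |].
  + unfold nome' at 1; rewrite <- Cexp_plus, <- Cexp_opp, <- Cexp_plus.
    replace (_ + _) with (RtoC 0) by (field; exact H0).
    rewrite Cexp_0; ring.
  + unfold nome'; rewrite Cexp_pow; change (INR 2) with 2%R; f_equal; field; exact H0.
- intros v; unfold theta_1.
  rewrite theta_prod_quasi_period; [| apply nome_lt_1 | apply Cexp_neq_0 |].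
  + unfold nome at 1; rewrite <- Cexp_plus, <- Cexp_opp, <- Cexp_plus.
    f_equal; f_equal; ring.
  + unfold nome; rewrite Cexp_pow; change (INR 2) with 2%R; f_equal; ring.
- intros v; unfold theta_2; rewrite theta_prod_period.
  + f_equal; f_equal; field; exact H0.
  + rewrite <- P; f_equal; field; exact H0.
- apply theta_prod_regular, nome_lt_1.
- apply theta_prod_regular, nome'_lt_1.
Qed.

Lemma euler3_neq_0 (k : C) : (Cmod k < 1)%R -> euler3 k <> 0.
Proof.
intros Hk E; pose proof (euler_product k Hk) as P; rewrite E in P.
apply C1_nz; rewrite <- P; ring.
Qed.

Lemma qpoch_m1 (k : C) :
  (Cmod k < 1)%R -> qpoch (- (1)) (k ^ 2) = 2 * euler2 k.
Proof.
intros Hk; rewrite qpoch_step by now apply Cmod_sqr_lt_1.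
unfold euler2; replace (- (1) * k ^ 2) with (- k ^ 2) by ring; ring.
Qed.

Lemma theta_prod_0 (a l k : C) : theta_prod a l k 0 = euler3 k * euler3 k.
Proof.
unfold theta_prod, euler3.
rewrite !Cmult_0_r, Cexp_0, !Cmult_1_r, Cmult_1_l; reflexivity.
Qed.

Lemma theta_prod_m1 (a l k v : C) :
  Cexp (l * v) = - (1) ->
  theta_prod a l k v = Cexp (a * v * v) * (euler4 k * euler4 k).
Proof.
intros E; unfold theta_prod, euler4.
replace (- l * v) with (- (l * v)) by ring; rewrite Cexp_opp, E.
replace (- k * - (1)) with k by ring.
replace (- k * / - (1)) with k by field; reflexivity.
Qed.

Lemma theta_prod_k (a l k v : C) :
  (Cmod k < 1)%R -> k <> 0 -> Cexp (l * v) = k ->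
  theta_prod a l k v = Cexp (a * v * v) * (2 * (euler2 k * euler2 k)).
Proof.
intros Hk Hk0 E; unfold theta_prod.
replace (- l * v) with (- (l * v)) by ring; rewrite Cexp_opp, E.
replace (- k * k) with (- k ^ 2) by ring.
replace (- k * / k) with (- (1)) by (field; exact Hk0).
rewrite qpoch_m1 by exact Hk; unfold euler2; ring.
Qed.

(** The square of f(tau)/f(-1/tau) for Weber's modular function f. It compares the ratio of
    [theta_1] to [theta_2] at [v = 0] with its expected value. *)
Definition root_factor : C :=
  (euler3 (nome tau) / euler3 (nome' tau)) ^ 2
  * Cexp (- (PI * Ci * (tau + / tau) / 12)).

(** Up to Gaussians, [v = 1 / 2] gives the square of [euler4] for tau and twice that of [euler2] for
    -1/tau; [v = tau / 2] exchanges the two. Multiplying the comparisons with [v = 0] cancels the 2,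
    and Euler's identity turns [euler2 * euler4] into the inverse of [euler3] for either nome. *)
Lemma root_factor_cube : root_factor ^ 3 = 1.
Proof.
pose proof tau_neq_0 as H0.
pose proof nome_lt_1 as Hq; pose proof nome'_lt_1 as Hq'.
assert (HPI : Cexp (PI * Ci) = - (1)) by apply Cexp_PI.
assert (E1 := theta_1_theta_2 (1 / 2) 0).
assert (E2 := theta_1_theta_2 (tau / 2) 0).
unfold theta_1, theta_2 in E1, E2; rewrite !theta_prod_0 in E1, E2.
rewrite (theta_prod_m1 0) in E1 by (rewrite <- HPI; f_equal; field).
rewrite <- (theta_prod_opp _ (2 * PI * Ci * / tau)) in E1.
rewrite (theta_prod_k (- (PI * Ci * / tau))) in E1;
  [| exact Hq' | apply Cexp_neq_0 | unfold nome'; f_equal; field; exact H0].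
rewrite (theta_prod_k 0) in E2;
  [| exact Hq | apply Cexp_neq_0 | unfold nome; f_equal; field].
rewrite (theta_prod_m1 (- (PI * Ci * / tau))) in E2
  by (rewrite <- HPI; f_equal; field; exact H0).
replace (0 * (1 / 2) * (1 / 2)) with (RtoC 0) in E1 by ring.
replace (0 * (tau / 2) * (tau / 2)) with (RtoC 0) in E2 by ring.
rewrite Cexp_0 in E1, E2.
pose proof (euler_product _ Hq) as P; pose proof (euler_product _ Hq') as P'.
pose proof (euler3_neq_0 _ Hq) as N; pose proof (euler3_neq_0 _ Hq') as N'.
unfold root_factor.
replace (((euler3 (nome tau) / euler3 (nome' tau)) ^ 2
          * Cexp (- (PI * Ci * (tau + / tau) / 12))) ^ 3)
  with ((euler3 (nome tau) / euler3 (nome' tau)) ^ 6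
        * (Cexp (- (PI * Ci * / tau) * (1 / 2) * (1 / 2))
           * Cexp (- (PI * Ci * / tau) * (tau / 2) * (tau / 2)))).
(* The two Gaussians have exponents -pi i/(4 tau) and -pi i tau/4, and 1/4 is three times 1/12. *)
2: { rewrite <- Cexp_plus.
     replace (_ + _) with (INR 3 * (- (PI * Ci * (tau + / tau) / 12)))
       by (change (INR 3) with (1 + 1 + 1)%R; rewrite !RtoC_plus; field; exact H0).
     rewrite <- Cexp_pow; ring. }
set (a := Cexp (- (PI * Ci * / tau) * (1 / 2) * (1 / 2))) in *.
set (b := Cexp (- (PI * Ci * / tau) * (tau / 2) * (tau / 2))) in *.
set (p2 := euler2 (nome tau)) in *; set (p3 := euler3 (nome tau)) in *.
set (p4 := euler4 (nome tau)) in *; set (r2 := euler2 (nome' tau)) in *.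
set (r3 := euler3 (nome' tau)) in *; set (r4 := euler4 (nome' tau)) in *.
clearbody a b p2 p3 p4 r2 r3 r4.
assert (X : p3 ^ 6 * (a * b) = r3 ^ 6).
{ transitivity (/ 2 * (r2 * r3 * r4) ^ 2 * (p3 ^ 6 * (a * b)) * 2);
    [rewrite P'; field |].
  transitivity (/ 2 * p3 ^ 2 * r3 ^ 2 * (p3 * p3 * (a * (2 * (r2 * r2))))
                * (p3 * p3 * (b * (r4 * r4)))); [field |].
  rewrite <- E1, <- E2.
  transitivity ((p2 * p3 * p4) ^ 2 * r3 ^ 6);
    [field |].
  rewrite P; ring. }
transitivity (p3 ^ 6 * (a * b) / r3 ^ 6); [field; exact N' |].
rewrite X; field; exact N'.
Qed.

End Modular.

(** * The inversion relation for the infinite products *)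

Lemma tends_root_factor {T : Type} (F : (T -> Prop) -> Prop) {FF : Filter F}
  (X : T -> C) (tau : C) :
  (0 < Im tau)%R -> tends F X tau ->
  tends F (fun t => root_factor (X t)) (root_factor tau).
Proof.
intros Ht HX.
assert (H3 : forall k (Y : T -> C), (Cmod k < 1)%R -> tends F Y k ->
  tends F (fun t => euler3 (Y t)) (euler3 k)).
{ intros k Y Hk HY; unfold euler3.
  apply (tends_qpoch F (fun t => - Y t) (fun t => Y t ^ 2));
    [now apply Cmod_sqr_lt_1 | now apply tends_opp | now apply tends_pow]. }
assert (Hi : tends F (fun t => / X t) (/ tau))
  by (apply tends_inv; [exact FF | exact HX | now apply tau_neq_0]).
assert (Hc : forall c : C, tends F (fun _ => c) c)
  by (intros; now apply tends_const).
assert (Hn : tends F (fun t => nome (X t)) (nome tau))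
  by (apply (tends_Cexp F (fun t => PI * Ci * X t)), tends_mult; auto).
assert (Hn' : tends F (fun t => nome' (X t)) (nome' tau))
  by (apply (tends_Cexp F (fun t => - (PI * Ci * / X t))), tends_opp, tends_mult;
      auto).
pose proof (euler3_neq_0 _ (nome'_lt_1 _ Ht)) as H0.
unfold root_factor.
apply (tends_mult F (fun t => (euler3 (nome (X t)) / euler3 (nome' (X t))) ^ 2)).
- apply (tends_pow F (fun t => euler3 (nome (X t)) / euler3 (nome' (X t)))).
  apply tends_div; [exact FF | | | exact H0].
  + apply H3; [now apply nome_lt_1 | exact Hn].
  + apply H3; [now apply nome'_lt_1 | exact Hn'].
- apply (tends_Cexp F (fun t => - (PI * Ci * (X t + / X t) / 12))), tends_opp.
  1: exact FF.
  apply (tends_mult F (fun t => PI * Ci * (X t + / X t))); [| apply Hc].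
  apply tends_mult; [exact FF | apply Hc |].
  apply tends_plus; auto.
Qed.

Lemma Im_Cexp_Ci (phi : R) : Im (Cexp (Ci * phi)) = sin phi.
Proof.
unfold Cexp; simpl.
replace (0 * phi - 1 * 0)%R with 0%R by ring.
replace (0 * 0 + 1 * phi)%R with phi by ring.
rewrite exp_0; ring.
Qed.

(** The real part alone separates 1 from the other roots, so the continuity argument can use a real
    function. *)
Lemma cube_root_of_1 (z : C) : z ^ 3 = 1 -> z = 1 \/ Re z = (- 1 / 2)%R.
Proof.
intros E; destruct z as [a b]; simpl.
assert (E1 : (a * a * a - 3 * a * b * b = 1)%R).
{ apply (f_equal Re) in E; simpl in E; lra. }
assert (E2 : (b * (3 * a * a - b * b) = 0)%R).
{ apply (f_equal Im) in E; simpl in E; lra. }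
destruct (Req_dec b 0) as [Hb | Hb].
- left; subst b.
  assert (H : ((a - 1) * ((a + / 2) * (a + / 2) + 3 / 4) = 0)%R) by lra.
  apply Rmult_integral in H; destruct H as [H | H]; [| nra].
  apply injective_projections; simpl; lra.
- right.
  assert (H : (3 * a * a - b * b = 0)%R)
    by (apply Rmult_integral in E2; tauto).
  (* Substituting [b * b = 3 * a * a] leaves 8 a^3 + 1 = 0; the second factor is 4 a^2 - 2 a + 1 as
     a sum of squares. *)
  assert (H8 : ((2 * a + 1) * ((2 * a - / 2) * (2 * a - / 2) + 3 / 4) = 0)%R).
  { assert (b * b = 3 * a * a)%R by lra.
    assert (a * b * b = a * (3 * a * a))%R by (rewrite Rmult_assoc; f_equal; lra).
    lra. }
  apply Rmult_integral in H8; destruct H8 as [H8 | H8]; [lra | nra].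
Qed.

Lemma root_factor_i : root_factor Ci = 1.
Proof.
assert (Hi : (0 < Im Ci)%R) by (simpl; lra).
assert (HC : Ci <> 0) by (intros E; injection E; lra).
assert (HI : / Ci = - Ci).
{ replace (- Ci) with (/ Ci * - (Ci * Ci)) by (field; exact HC).
  replace (Ci * Ci) with (- (1)); [ring |].
  apply injective_projections; simpl; ring. }
assert (E : nome Ci = nome' Ci)
  by (unfold nome, nome'; rewrite HI; f_equal; ring).
unfold root_factor; rewrite <- E, HI.
replace (- (PI * Ci * (Ci + - Ci) / 12)) with (RtoC 0) by field.
rewrite Cexp_0; field; apply euler3_neq_0, nome_lt_1, Hi.
Qed.

(** The offset 1/4 lies midway between 1 and -1/2, so the function takes the values 3/4 and -3/4 and
    a change of root would force a zero. *)
Lemma root_factor_continuity_pt (phi : R) :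
  (0 < sin phi)%R ->
  continuity_pt (fun x => Re (root_factor (Cexp (Ci * RtoC x))) - 1 / 4)%R phi.
Proof.
intros Hs; apply continuity_pt_minus; [| apply continuity_pt_const; now intros ? ?].
apply continuity_pt_filterlim, filterlim_locally; intros eps.
assert (HX : tends (locally phi) (fun x : R => Cexp (Ci * RtoC x))
               (Cexp (Ci * phi))).
{ apply tends_Cexp, tends_mult; [exact _ | exact _ | |].
  - apply tends_const; exact _.
  - intros e He; exists (mkposreal e He); intros y Hy.
    rewrite <- RtoC_minus, Cmod_R; exact Hy. }
assert (Hi : (0 < Im (Cexp (Ci * phi)))%R) by now rewrite Im_Cexp_Ci.
generalize (tends_root_factor (locally phi) _ _ Hi HX eps (cond_pos eps)).
apply filter_imp; intros x Hx.
change (Rabs (Re (root_factor (Cexp (Ci * RtoC x)))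
              - Re (root_factor (Cexp (Ci * RtoC phi)))) < eps)%R.
eapply Rle_lt_trans; [| exact Hx].
exact (re_le_Cmod (root_factor (Cexp (Ci * RtoC x))
                   - root_factor (Cexp (Ci * RtoC phi)))).
Qed.

(* Along the unit half-circle the cube root of unity [root_factor] varies
   continuously, and it is 1 at its midpoint i. *)
Lemma root_factor_circle (tau : C) :
  (0 < Im tau)%R -> Cmod tau = 1%R -> root_factor tau = 1.
Proof.
intros Hi Hc.
set (f := fun x : R => (Re (root_factor (Cexp (Ci * RtoC x))) - 1 / 4)%R).
set (phi := acos (Re tau)).
assert (Hr : (Re tau ^ 2 + Im tau ^ 2 = 1)%R)
  by (rewrite <- Cmod2_alt, Hc; ring).
assert (Hr1 : (- 1 <= Re tau <= 1)%R) by nra.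
assert (Hcos : cos phi = Re tau) by now apply cos_acos.
assert (Hphi : (0 <= phi <= PI)%R) by apply acos_bound.
assert (Hsin : sin phi = Im tau).
{ pose proof (sin2_cos2 phi) as E; unfold Rsqr in E; rewrite Hcos in E.
  assert (0 <= sin phi)%R by (apply sin_ge_0; lra).
  nra. }
assert (Et : tau = Cexp (Ci * phi)).
{ unfold Cexp; simpl.
  replace (0 * phi - 1 * 0)%R with 0%R by ring.
  replace (0 * 0 + 1 * phi)%R with phi by ring.
  rewrite exp_0, !Rmult_1_l, Hcos, Hsin; now destruct tau. }
assert (Hp : (0 < phi < PI)%R).
{ split; [destruct (Req_dec phi 0) as [E | E] | destruct (Req_dec phi PI) as [E | E]];
    try lra; rewrite E in Hsin; rewrite ?sin_0, ?sin_PI in Hsin; lra. }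
assert (Hmid : f (PI / 2)%R = (3 / 4)%R).
{ unfold f; replace (Cexp (Ci * RtoC (PI / 2))) with Ci.
  - rewrite root_factor_i; simpl; lra.
  - unfold Cexp; simpl.
    replace (0 * (PI / 2) - 1 * 0)%R with 0%R by ring.
    replace (0 * 0 + 1 * (PI / 2))%R with (PI / 2)%R by ring.
    rewrite exp_0, cos_PI2, sin_PI2; unfold Ci; f_equal; ring. }
assert (Hcube : forall x, (0 < x < PI)%R ->
          root_factor (Cexp (Ci * RtoC x)) = 1 \/ f x = (- 3 / 4)%R).
{ intros x Hx.
  destruct (cube_root_of_1 (root_factor (Cexp (Ci * RtoC x)))) as [H | H].
  - apply root_factor_cube; rewrite Im_Cexp_Ci; now apply sin_gt_0.
  - now left.
  - right; unfold f; rewrite H; lra. }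
assert (Hnz : forall x, (0 < x < PI)%R -> f x <> 0%R).
{ intros x Hx E; destruct (Hcube x Hx) as [H | H]; [| lra].
  unfold f in E; rewrite H in E; simpl in E; lra. }
rewrite Et; destruct (Hcube phi Hp) as [H | H]; [exact H | exfalso].
assert (Hcont : forall x, (0 < x < PI)%R -> continuity_pt f x)
  by (intros x Hx; apply root_factor_continuity_pt; now apply sin_gt_0).
(* The intermediate value theorem is applied to functions negative at the left end, hence the change
   of sign beyond the midpoint. *)
destruct (Rtotal_order phi (PI / 2)) as [Hlt | [Heq | Hgt]].
- destruct (IVT_interv f phi (PI / 2)) as [x [Hx E]];
    [intros; apply Hcont; lra | lra | lra | lra |].
  apply (Hnz x); lra.
- rewrite Heq in H; lra.
- destruct (IVT_interv (fun x => - f x)%R (PI / 2) phi) as [x [Hx E]];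
    [intros; apply continuity_pt_opp, Hcont; lra | lra | lra | lra |].
  apply (Hnz x); lra.
Qed.

Section Inversion.

Variable theta : C.
Hypotheses (Hmod : Cmod theta = 1%R)
  (HRe : (0 < Re theta)%R) (HIm : (0 < Im theta)%R).

Lemma theta_neq_0 : theta <> 0.
Proof. apply Cmod_gt_0; rewrite Hmod; lra. Qed.

Lemma Im_theta_sqr : (0 < Im (theta ^ 2))%R.
Proof.
destruct theta as [a b]; simpl in *; nra.
Qed.

Definition num_base : C := Cexp (2 * PI * Ci * theta ^ 2).
Definition den_base : C := Cexp (- (2 * PI * Ci * / theta ^ 2)).

Lemma num_base_nome : num_base = nome (theta ^ 2) ^ 2.
Proof.
unfold num_base, nome; rewrite Cexp_pow; change (INR 2) with 2%R; f_equal; ring.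
Qed.

Lemma den_base_nome : den_base = nome' (theta ^ 2) ^ 2.
Proof.
unfold den_base, nome'; rewrite Cexp_pow; change (INR 2) with 2%R; f_equal.
field; exact theta_neq_0.
Qed.

(** Because 2 pi theta c is pi i (theta^2 + 1) for c = [c_ theta], the shift in the argument only
    contributes the factor [- nome (theta ^ 2)], and the numerator becomes one half of a theta
    product. *)
Lemma faddeev_num_nome (w : C) :
  faddeev_num theta w = qpoch (- nome (theta ^ 2) * Cexp (2 * PI * theta * w))
                              (nome (theta ^ 2) ^ 2).
Proof.
unfold faddeev_num; rewrite <- num_base_nome; unfold num_base; f_equal.
transitivity (Cexp (PI * Ci) * Cexp (PI * Ci * theta ^ 2)
              * Cexp (2 * PI * theta * w)).
- rewrite <- !Cexp_plus; f_equal; unfold c_; field; exact theta_neq_0.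
- rewrite Cexp_PI; unfold nome; ring.
Qed.

Lemma faddeev_den_nome (w : C) :
  faddeev_den theta w = qpoch (- nome' (theta ^ 2) * Cexp (2 * PI * / theta * w))
                              (nome' (theta ^ 2) ^ 2).
Proof.
unfold faddeev_den; rewrite <- den_base_nome; unfold den_base; f_equal.
transitivity (Cexp (- (PI * Ci)) * Cexp (- (PI * Ci * / theta ^ 2))
              * Cexp (2 * PI * / theta * w)).
- rewrite <- !Cexp_plus; f_equal; unfold c_.
  assert (HC : Ci * Ci = - (1)) by (apply injective_projections; simpl; ring).
  field; exact theta_neq_0.
- rewrite Cexp_opp, Cexp_PI; unfold nome'.
  replace (/ - (1)) with (- (1)) by field; ring.
Qed.

(** At [v = - Ci * theta * w] the two halves of each theta product are the values at [w] and [- w],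
    and the Gaussian of [theta_2] becomes that in [w]. Comparison with [v = 0] leaves the squared
    quotient of the [euler3] values, which [root_factor_circle] evaluates. *)
Lemma faddeev_inversion (w : C) :
  faddeev_num theta w * faddeev_num theta (- w)
  = Cexp (PI * Ci * w * w + PI * Ci * (theta ^ 2 + / theta ^ 2) / 12)
    * (faddeev_den theta w * faddeev_den theta (- w)).
Proof.
pose proof theta_neq_0 as H0; pose proof Im_theta_sqr as Hi.
assert (HC : Ci * Ci = - (1)) by (apply injective_projections; simpl; ring).
assert (Hroot : root_factor (theta ^ 2) = 1).
{ apply root_factor_circle; [exact Hi |].
  rewrite Cmod_pow, Hmod; ring. }
pose proof (theta_1_theta_2 (theta ^ 2) Hi (- Ci * theta * w) 0) as E.
unfold theta_1, theta_2 in E; rewrite !theta_prod_0 in E.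
unfold theta_prod in E.
replace (0 * (- Ci * theta * w) * (- Ci * theta * w)) with (RtoC 0) in E by ring.
replace (2 * PI * Ci * (- Ci * theta * w)) with (2 * PI * theta * w) in E
  by (transitivity (- (Ci * Ci) * (2 * PI * theta * w)); [rewrite HC |]; ring).
replace (- (2 * PI * Ci) * (- Ci * theta * w)) with (2 * PI * theta * (- w)) in E
  by (transitivity ((Ci * Ci) * (2 * PI * theta * w)); [rewrite HC |]; ring).
replace (2 * PI * Ci * / theta ^ 2 * (- Ci * theta * w))
  with (2 * PI * / theta * w) in E
  by (transitivity (- (Ci * Ci) * (2 * PI * / theta * w));
      [rewrite HC |]; field; exact H0).
replace (- (2 * PI * Ci * / theta ^ 2) * (- Ci * theta * w))
  with (2 * PI * / theta * (- w)) in E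
  by (transitivity ((Ci * Ci) * (2 * PI * / theta * w));
      [rewrite HC |]; field; exact H0).
replace (- (PI * Ci * / theta ^ 2) * (- Ci * theta * w) * (- Ci * theta * w))
  with (PI * Ci * w * w) in E
  by (transitivity (- (Ci * Ci) * (PI * Ci * w * w));
      [rewrite HC |]; field; exact H0).
rewrite Cexp_0, Cmult_1_l in E.
rewrite <- !faddeev_num_nome, <- !faddeev_den_nome in E.
unfold root_factor in Hroot.
rewrite Cexp_opp in Hroot.
pose proof (euler3_neq_0 _ (nome'_lt_1 _ Hi)) as N'.
rewrite Cexp_plus.
set (p := euler3 (nome (theta ^ 2))) in *.
set (p' := euler3 (nome' (theta ^ 2))) in *.
set (g := Cexp (PI * Ci * (theta ^ 2 + / theta ^ 2) / 12)) in *.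
assert (Hg : g <> 0) by apply Cexp_neq_0.
assert (Hpg : p * p = g * (p' * p')).
{ transitivity ((p / p') ^ 2 * / g * (g * (p' * p'))); [field; auto |].
  rewrite Hroot; ring. }
rewrite Hpg in E.
set (A := faddeev_num theta w * faddeev_num theta (- w)) in *.
transitivity (A * (p' * p') * / (p' * p')); [field; exact N' |].
rewrite E; field; exact N'.
Qed.

End Inversion.

(** * The inversion relation for Phi *)

Instance locally'_proper (z : C) : ProperFilter (locally' z).
Proof.
constructor; [| apply within_filter, locally_filter].
intros P [eps HP].
assert (He : (0 < eps / 2)%R) by (pose proof (cond_pos eps); lra).
exists (z + RtoC (eps / 2)); apply HP.
- apply C_NormedModule_mixin_compat1.
  change (Cmod (z + RtoC (eps / 2) - z) < eps)%R.
  replace (z + RtoC (eps / 2) - z) with (RtoC (eps / 2)) by ring.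
  rewrite Cmod_R, Rabs_pos_eq; lra.
- intros E; assert (E1 : RtoC (eps / 2) = 0).
  { replace (RtoC (eps / 2)) with (z + RtoC (eps / 2) - z) by ring.
    rewrite E; ring. }
  apply RtoC_inj in E1; lra.
Qed.

Lemma tends_id' (z : C) : tends (locally' z) (fun w => w) z.
Proof.
intros eps Heps; unfold locally', within.
assert (H : tends (locally z) (fun w : C => w) z)
  by (apply filterlim_tends, filterlim_id).
generalize (H eps Heps); apply filter_imp; auto.
Qed.

Lemma locally'_neq (z : C) : locally' z (fun w => w - z <> 0).
Proof.
unfold locally', within; apply filter_forall; intros w Hw E; apply Hw.
change (@eq C w z); replace w with ((w - z) + z) by ring; rewrite E; ring.
Qed.

Lemma locally'_opp (z : C) (P : C -> Prop) :
  locally' (- z) P -> locally' z (fun w => P (- w)).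
Proof.
assert (Hopp : forall a b e : R, (Rabs (a - b) < e -> Rabs (- a - - b) < e)%R).
{ intros a b e He; rewrite <- Rabs_Ropp.
  replace (- (- a - - b))%R with (a - b)%R by ring; exact He. }
intros [eps HP]; exists eps; intros w [H1 H2] Hw; apply HP.
- split; [exact (Hopp _ _ _ H1) | exact (Hopp _ _ _ H2)].
- intros E; apply Hw; change (@eq C w z).
  replace w with (- - w) by ring; rewrite E; ring.
Qed.

Lemma tends_one_sub_Cexp (b z : C) :
  tends (locally' z) (fun w => (1 - Cexp (b * (w - z))) / (w - z)) (- b).
Proof.
destruct (Cexp_quadratic (Cmod b)) as [K [HK HE]].
pose proof (Cmod_ge_0 b) as Hb.
intros eps Heps.
set (c := (K * (Cmod b * Cmod b) + 1)%R).
assert (Hc : (0 < c)%R)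
  by (unfold c; assert (0 <= K * (Cmod b * Cmod b))%R
        by (repeat apply Rmult_le_pos; lra); lra).
assert (H1 : (0 < Rmin 1 (eps / c))%R)
  by (apply Rmin_pos; [lra | now apply Rdiv_lt_0_compat]).
generalize (filter_and _ _ (locally'_neq z) (tends_id' z _ H1)).
apply filter_imp; intros w [Hu Hd].
set (u := w - z) in *.
assert (Hu1 : (Cmod u <= 1)%R)
  by (left; eapply Rlt_le_trans; [exact Hd | apply Rmin_l]).
assert (Hu2 : (Cmod u < eps / c)%R)
  by (eapply Rlt_le_trans; [exact Hd | apply Rmin_r]).
apply Rlt_div_r in Hu2; [| exact Hc].
pose proof (proj1 (Cmod_gt_0 u) Hu) as Hu0.
replace ((1 - Cexp (b * u)) / u - - b)
  with (- (Cexp (b * u) - 1 - b * u) / u) by (field; exact Hu).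
rewrite Cmod_div, Cmod_opp by exact Hu.
apply Rlt_div_l; [exact Hu0 |].
eapply Rle_lt_trans.
- apply HE; rewrite Cmod_mult; nra.
- rewrite Cmod_mult.
  replace (K * (Cmod b * Cmod u * (Cmod b * Cmod u)))%R
    with ((Cmod u * (K * (Cmod b * Cmod b))) * Cmod u)%R by ring.
  apply Rmult_lt_compat_r; [exact Hu0 |]; unfold c in Hu2; nra.
Qed.

(** Only the factor [j] vanishes at [z]; divided by [w - z] it tends to [- b], and all other factors
    are continuous and nonzero there. This resolves the points where [faddeev_num] and [faddeev_den]
    vanish together. *)
Lemma qpoch_simple_zero (y q b z : C) (j : nat) :
  (Cmod q < 1)%R -> q <> 0 -> y * q ^ j = 1 ->
  exists L : C, (b <> 0 -> L <> 0) /\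
    tends (locally' z) (fun w => qpoch (y * Cexp (b * (w - z))) q / (w - z)) L.
Proof.
intros Hq Hq0 Hj.
assert (Hy : y <> 0).
{ intros E; apply C1_nz; rewrite <- Hj, E; ring. }
(* The powers of [q] have pairwise different moduli because these decrease strictly. *)
assert (Hne : forall i, i <> j -> y * q ^ i <> 1).
{ intros i Hi E.
  assert (Em : (Cmod q ^ i = Cmod q ^ j)%R).
  { rewrite <- !Cmod_pow; f_equal.
    transitivity (/ y * (y * q ^ i)); [field; exact Hy |].
    rewrite E, <- Hj; field; exact Hy. }
  pose proof (proj1 (Cmod_gt_0 q) Hq0) as Hq1.
  assert (Hlt : forall a d, (Cmod q ^ (a + S d) < Cmod q ^ a)%R).
  { intros a d; rewrite pow_add.
    assert (0 < Cmod q ^ a)%R by now apply pow_lt.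
    assert (Cmod q ^ S d < 1)%R.
    { rewrite <- tech_pow_Rmult.
      assert (Cmod q ^ d <= 1)%R by (rewrite <- (pow1 d); apply pow_incr; lra).
      assert (0 < Cmod q ^ d)%R by now apply pow_lt.
      nra. }
    nra. }
  destruct (Nat.lt_total i j) as [H | [H | H]]; [| lia |].
  - specialize (Hlt i (j - i - 1)%nat).
    replace (i + S (j - i - 1))%nat with j in Hlt by lia; lra.
  - specialize (Hlt j (i - j - 1)%nat).
    replace (j + S (i - j - 1))%nat with i in Hlt by lia; lra. }
assert (HY : tends (locally' z) (fun w => y * Cexp (b * (w - z))) y).
{ replace y with (y * Cexp (b * (z - z))) at 1.
  2: { replace (b * (z - z)) with (RtoC 0) by ring; rewrite Cexp_0; ring. }
  apply tends_mult; [exact _ | apply tends_const; exact _ |].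
  apply (tends_Cexp (locally' z) (fun w => b * (w - z))).
  apply tends_mult; [exact _ | apply tends_const; exact _ |].
  apply tends_minus; [exact _ | apply tends_id' | apply tends_const; exact _]. }
exists (qprod y q j * (- b) * qpoch (y * q ^ S j) q); split.
- intros Hb; apply Cmult_neq_0; [apply Cmult_neq_0 |].
  + apply qprod_neq_0; intros i Hi; apply Hne; lia.
  + intros E; apply Hb; replace b with (- - b) by ring; rewrite E; ring.
  + apply qpoch_neq_0; [exact Hq |]; intros i.
    rewrite <- Cmult_assoc, <- Cpow_add_r; apply Hne; lia.
- apply (tends_ext _ (fun w => qprod (y * Cexp (b * (w - z))) q j
           * ((1 - Cexp (b * (w - z))) / (w - z))
           * qpoch (y * Cexp (b * (w - z)) * q ^ S j) q)).
  + apply filter_forall; intros w.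
    rewrite (qpoch_split (y * Cexp (b * (w - z))) q j Hq).
    rewrite (qpoch_step (y * Cexp (b * (w - z)) * q ^ j) q Hq).
    replace (y * Cexp (b * (w - z)) * q ^ j)
      with ((y * q ^ j) * Cexp (b * (w - z))) by ring.
    replace (y * Cexp (b * (w - z)) * q ^ S j)
      with ((y * q ^ j) * Cexp (b * (w - z)) * q) by (rewrite Cpow_S; ring).
    rewrite Hj, !Cmult_1_l; unfold Cdiv; ring.
  + apply tends_mult; [exact _ | apply tends_mult; [exact _ | |] |].
    * apply (tends_Cprod (locally' z)
        (fun i w => 1 - y * Cexp (b * (w - z)) * q ^ i)); intros i.
      apply tends_minus; [exact _ | apply tends_const; exact _ |].
      apply tends_mult; [exact _ | exact HY | apply tends_const; exact _].
    * apply tends_one_sub_Cexp.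
    * apply (tends_qpoch (locally' z)
        (fun w => y * Cexp (b * (w - z)) * q ^ S j) (fun _ => q)).
      -- exact Hq.
      -- apply tends_mult; [exact _ | exact HY | apply tends_const; exact _].
      -- apply tends_const; exact _.
Qed.

Section PhiLimit.

Variable theta : C.
Hypotheses (Hmod : Cmod theta = 1%R)
  (HRe : (0 < Re theta)%R) (HIm : (0 < Im theta)%R).

Lemma Cinv_theta : / theta = Cconj theta.
Proof.
pose proof (theta_neq_0 theta Hmod) as H0.
assert (E : theta * Cconj theta = 1).
{ rewrite <- Cmod2_conj, Hmod; apply injective_projections; simpl; ring. }
transitivity (/ theta * (theta * Cconj theta)); [rewrite E; ring |].
field; exact H0.
Qed.

(* Poles of [Phi] are the points [c + i j / theta + i k theta] with
   [j, k >= 0], so they lie on or above the height [Re theta]. *)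
Lemma faddeev_den_zero (z : C) (j : nat) :
  (Im z < Re theta)%R ->
  Cexp (2 * PI * / theta * (z - c_ theta)) * den_base theta ^ j = 1 ->
  exists i, Cexp (2 * PI * theta * (z + c_ theta)) * num_base theta ^ i = 1.
Proof.
intros Hz E.
pose proof (theta_neq_0 theta Hmod) as H0.
assert (HP : RtoC PI <> 0)
  by (intros E1; apply RtoC_inj in E1; pose proof PI_RGT_0; lra).
unfold den_base in E; rewrite Cexp_pow, <- Cexp_plus in E.
apply Cexp_eq_1 in E; destruct E as [k Hk].
assert (Ez : z = c_ theta + Ci * / theta * INR j + Ci * theta * IZR k).
{ replace (Ci * theta * IZR k) with (theta / (2 * PI) * (2 * PI * Ci * IZR k))
    by (field; exact HP).
  rewrite <- Hk; field; auto. }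
(* On the unit circle [/ theta] is the conjugate, so all three terms have heights that are multiples
   of [Re theta]; staying below [Re theta] makes [k] negative. *)
assert (Him : (Im z = Re theta * (1 + INR j + IZR k))%R).
{ rewrite Ez; unfold c_; rewrite Cinv_theta; destruct theta as [a b].
  simpl; field. }
assert (Hk0 : (k < 0)%Z).
{ apply lt_IZR; pose proof (pos_INR j).
  assert (INR j + IZR k < 0)%R by nra; lra. }
(* This index cancels the multiples of theta^2 in the exponent and leaves 2 pi i (1 + j). *)
exists (Z.to_nat (- 1 - k)).
unfold num_base; rewrite Cexp_pow, <- Cexp_plus, INR_IZR_INZ, Z2Nat.id by lia.
rewrite <- (Cexp_2PI (1 + Z.of_nat j)); f_equal.
rewrite Ez, minus_IZR, plus_IZR, <- INR_IZR_INZ, RtoC_minus, RtoC_plus.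
unfold c_; field; exact H0.
Qed.

Lemma den_base_lt_1 : (Cmod (den_base theta) < 1)%R.
Proof.
rewrite (den_base_nome theta Hmod).
apply Cmod_sqr_lt_1, nome'_lt_1, Im_theta_sqr; assumption.
Qed.

Lemma num_base_lt_1 : (Cmod (num_base theta) < 1)%R.
Proof.
rewrite (num_base_nome theta).
apply Cmod_sqr_lt_1, nome_lt_1, Im_theta_sqr; assumption.
Qed.

(** Either the denominator is nonzero at [z] and continuity suffices, or both functions have simple
    zeros and the limit is the quotient of the slopes. The second conclusion allows the quotients
    near [z] to be handled as true fractions. *)
Lemma tends_faddeev_quotient (z : C) :
  (Im z < Re theta)%R ->
  exists L : C, tends (locally' z)
              (fun w => faddeev_num theta w / faddeev_den theta w) L /\
            locally' z (fun w => faddeev_den theta w <> 0).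
Proof.
intros Hz.
pose proof (theta_neq_0 theta Hmod) as H0.
assert (HP : 2 * PI <> 0).
{ rewrite <- RtoC_mult; intros E; apply RtoC_inj in E.
  pose proof PI_RGT_0; lra. }
assert (HB : 2 * PI * / theta <> 0).
{ apply Cmult_neq_0; [exact HP |].
  intros E; apply C1_nz; replace (RtoC 1) with (theta * / theta)
    by (field; exact H0); rewrite E; ring. }
pose proof den_base_lt_1 as Hd; pose proof num_base_lt_1 as Hn.
assert (EN : forall w, faddeev_num theta w
  = qpoch (Cexp (2 * PI * theta * (z + c_ theta))
           * Cexp (2 * PI * theta * (w - z))) (num_base theta)).
{ intros w; rewrite <- Cexp_plus; unfold faddeev_num, num_base.
  f_equal; f_equal; ring. }
assert (ED : forall w, faddeev_den theta w
  = qpoch (Cexp (2 * PI * / theta * (z - c_ theta))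
           * Cexp (2 * PI * / theta * (w - z))) (den_base theta)).
{ intros w; rewrite <- Cexp_plus; unfold faddeev_den, den_base.
  f_equal; f_equal; ring. }
destruct (Classical_Prop.classic (exists j,
    Cexp (2 * PI * / theta * (z - c_ theta)) * den_base theta ^ j = 1))
  as [[j Hj] | Hno].
- destruct (faddeev_den_zero z j Hz Hj) as [i Hi].
  destruct (qpoch_simple_zero _ _ (2 * PI * / theta) z j Hd (Cexp_neq_0 _) Hj)
    as [L1 [HL1 T1]].
  destruct (qpoch_simple_zero _ _ (2 * PI * theta) z i Hn (Cexp_neq_0 _) Hi)
    as [L2 [_ T2]].
  specialize (HL1 HB).
  exists (L2 / L1); split.
  + apply (tends_ext _ (fun w =>
      (qpoch (Cexp (2 * PI * theta * (z + c_ theta))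
              * Cexp (2 * PI * theta * (w - z))) (num_base theta) / (w - z))
      / (qpoch (Cexp (2 * PI * / theta * (z - c_ theta))
              * Cexp (2 * PI * / theta * (w - z))) (den_base theta) / (w - z)))).
    * generalize (filter_and _ _ (locally'_neq z)
                    (tends_neq_0 _ _ _ T1 HL1)).
      apply filter_imp; intros w [Hwz HD].
      rewrite EN, ED; field; split; [| exact Hwz].
      intros E; apply HD; rewrite E; field; exact Hwz.
    * apply tends_div; [exact _ | exact T2 | exact T1 | exact HL1].
  + generalize (tends_neq_0 _ _ _ T1 HL1); apply filter_imp.
    intros w HD E; apply HD; rewrite <- ED, E; unfold Cdiv; ring.
- assert (Hden : faddeev_den theta z <> 0).
  { apply qpoch_neq_0; [exact Hd |]; intros j E; apply Hno; now exists j. }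
  assert (Td : tends (locally' z) (faddeev_den theta) (faddeev_den theta z)).
  { apply (tends_qpoch (locally' z)
      (fun w => Cexp (2 * PI * / theta * (w - c_ theta)))
      (fun _ => den_base theta)); [exact Hd | | apply tends_const; exact _].
    apply (tends_Cexp (locally' z) (fun w => 2 * PI * / theta * (w - c_ theta))).
    apply tends_mult; [exact _ | apply tends_const; exact _ |].
    apply tends_minus; [exact _ | apply tends_id' | apply tends_const; exact _]. }
  assert (Tn : tends (locally' z) (faddeev_num theta) (faddeev_num theta z)).
  { apply (tends_qpoch (locally' z)
      (fun w => Cexp (2 * PI * theta * (w + c_ theta)))
      (fun _ => num_base theta)); [exact Hn | | apply tends_const; exact _].
    apply (tends_Cexp (locally' z) (fun w => 2 * PI * theta * (w + c_ theta))).
    apply tends_mult; [exact _ | apply tends_const; exact _ |].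
    apply tends_plus; [exact _ | apply tends_id' | apply tends_const; exact _]. }
  exists (faddeev_num theta z / faddeev_den theta z); split.
  + apply tends_div; [exact _ | exact Tn | exact Td | exact Hden].
  + exact (tends_neq_0 _ _ _ Td Hden).
Qed.

Lemma Phi_inversion (z : C) :
  (Rabs (Im z) < Re theta)%R ->
  Phi theta z * Phi theta (- z)
  = Cexp (PI * Ci * z * z + PI * Ci * (theta ^ 2 + / theta ^ 2) / 12).
Proof.
intros Hz; apply Rabs_def2 in Hz.
destruct (tends_faddeev_quotient z) as [L1 [T1 D1]]; [lra |].
destruct (tends_faddeev_quotient (- z)) as [L2 [T2 D2]];
  [change (- Im z < Re theta)%R; lra |].
assert (E1 : Phi theta z = L1) by exact (Clim_tends (locally' z) _ _ T1).
assert (E2 : Phi theta (- z) = L2) by exact (Clim_tends (locally' (- z)) _ _ T2).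
rewrite E1, E2.
apply (tends_unique (locally' z) (fun w =>
  faddeev_num theta w / faddeev_den theta w
  * (faddeev_num theta (- w) / faddeev_den theta (- w)))).
- apply tends_mult; [exact _ | exact T1 |].
  intros eps Heps; exact (locally'_opp z _ (T2 eps Heps)).
- apply (tends_ext _ (fun w =>
    Cexp (PI * Ci * w * w + PI * Ci * (theta ^ 2 + / theta ^ 2) / 12))).
  + generalize (filter_and _ _ D1 (locally'_opp z _ D2)).
    apply filter_imp; intros w [H1 H2].
    transitivity (faddeev_num theta w * faddeev_num theta (- w)
                  / (faddeev_den theta w * faddeev_den theta (- w))).
    * rewrite (faddeev_inversion theta Hmod HRe HIm); field; auto.
    * field; auto.
  + apply (tends_Cexp (locally' z) (fun w =>
      PI * Ci * w * w + PI * Ci * (theta ^ 2 + / theta ^ 2) / 12)).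
    apply tends_plus; [exact _ | | apply tends_const; exact _].
    apply tends_mult; [exact _ | | apply tends_id'].
    apply tends_mult; [exact _ | apply tends_const; exact _ | apply tends_id'].
Qed.

End PhiLimit.

(** * The product over residues modulo N *)

Lemma Cprod_ext_lt (f g : nat -> C) (n : nat) :
  (forall j, (j < n)%nat -> f j = g j) -> Cprod f n = Cprod g n.
Proof.
induction n as [| n IH]; intros H; simpl; [reflexivity |].
rewrite IH, H; auto.
Qed.

Lemma Cprod_mult (f g : nat -> C) (n : nat) :
  Cprod (fun j => f j * g j) n = Cprod f n * Cprod g n.
Proof.
induction n as [| n IH]; simpl; [ring | rewrite IH; ring].
Qed.

Lemma Cprod_S_l (f : nat -> C) (n : nat) :
  Cprod f (S n) = f O * Cprod (fun j => f (S j)) n.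
Proof.
induction n as [| n IH]; [simpl; ring |].
transitivity (Cprod f (S n) * f (S n)); [reflexivity |].
rewrite IH; simpl; ring.
Qed.

Lemma Cprod_rev (f : nat -> C) (n : nat) :
  Cprod (fun j => f (n - 1 - j)%nat) n = Cprod f n.
Proof.
induction n as [| n IH]; [reflexivity |].
rewrite Cprod_S_l; simpl Cprod; rewrite Cmult_comm; f_equal.
- rewrite <- IH; apply Cprod_ext; intros j; f_equal; lia.
- f_equal; lia.
Qed.

Lemma Cprod_Cexp (f : nat -> C) (n : nat) :
  Cprod (fun j => Cexp (f j)) n = Cexp (Csum f n).
Proof.
induction n as [| n IH]; simpl; [symmetry; apply Cexp_0 |].
now rewrite IH, Cexp_plus.
Qed.

Lemma Csum_quadratic (a b c : C) (n : nat) :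
  Csum (fun j => a + b * INR j + c * INR j * INR j) n
  = a * INR n + b * INR n * (INR n - 1) / 2
    + c * INR n * (INR n - 1) * (2 * INR n - 1) / 6.
Proof.
induction n as [| n IH].
- simpl; field.
- rewrite S_INR, RtoC_plus; simpl Csum; rewrite IH; field.
Qed.

Lemma periodic_Z (N : Z) (f : Z -> C) :
  (forall n, f (n + N)%Z = f n) -> forall k n, f (n + k * N)%Z = f n.
Proof.
intros H.
assert (Hn : forall (k : nat) n, f (n + Z.of_nat k * N)%Z = f n).
{ induction k as [| k IH]; intros n.
  - f_equal; lia.
  - rewrite Nat2Z.inj_succ, <- (IH n), <- (H (n + Z.of_nat k * N)%Z).
    f_equal; lia. }
intros k n; destruct (Z_le_gt_dec 0 k) as [Hk | Hk].
- rewrite <- (Z2Nat.id k Hk); apply Hn.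
- rewrite <- (Hn (Z.to_nat (- k)) (n + k * N)%Z), Z2Nat.id by lia.
  f_equal; lia.
Qed.

Lemma frac_part_add_Z (r : R) (z : Z) :
  (0 <= r < 1)%R -> frac_part (r + IZR z) = r.
Proof.
intros H; unfold frac_part.
rewrite <- (Int_part_spec (r + IZR z) z); lra.
Qed.

(** [a] and [b] stand for j/N and the fractional part. Replacing [t] by [- t] and reflecting both
    [a] and [b] in the interval from 0 to 1 - 1/N changes the sign of the value. *)
Definition D_arg (N : nat) (theta : C) (t a b : R) : C :=
  RtoC t + (1 - / INR N) * c_ theta - Ci * / theta * RtoC a - Ci * theta * RtoC b.

Lemma Im_D_arg (N : nat) (theta : C) (t a b : R) :
  (0 < N)%nat -> Cmod theta = 1%R ->
  Im (D_arg N theta t a b) = (Re theta * (1 - / INR N - a - b))%R.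
Proof.
intros HN Hmod; apply lt_0_INR in HN.
unfold D_arg, c_; rewrite (Cinv_theta theta Hmod), <- RtoC_inv by lra.
destruct theta as [p r]; simpl; field; lra.
Qed.

(* The residue of [j + n] modulo [N], for [0 <= j, n < N]. *)
Definition wrap (N n j : nat) : nat :=
  if (j + n <? N)%nat then (j + n)%nat else (j + n - N)%nat.

Lemma wrap_lt (N n j : nat) : (n < N)%nat -> (j < N)%nat -> (wrap N n j < N)%nat.
Proof.
unfold wrap; destruct (Nat.ltb_spec (j + n) N); lia.
Qed.

Lemma frac_part_wrap (N n j : nat) :
  (n < N)%nat -> (j < N)%nat ->
  frac_part ((INR j + IZR (Z.of_nat n)) / INR N) = (INR (wrap N n j) / INR N)%R.
Proof.
intros Hn Hj; assert (HN : (0 < INR N)%R) by (apply lt_0_INR; lia).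
assert (Hw : (0 <= INR (wrap N n j) / INR N < 1)%R).
{ split; [apply Rdiv_le_0_compat; [apply pos_INR | exact HN] |].
  apply Rlt_div_l; [exact HN |]; rewrite Rmult_1_l.
  now apply lt_INR, wrap_lt. }
rewrite <- INR_IZR_INZ, <- plus_INR; revert Hw; unfold wrap.
destruct (Nat.ltb_spec (j + n) N) as [H | H]; intros Hw.
- etransitivity; [| exact (frac_part_add_Z _ 0 Hw)]; f_equal; lra.
- etransitivity; [| exact (frac_part_add_Z _ 1 Hw)]; f_equal.
  rewrite (minus_INR (j + n) N) by lia; field; lra.
Qed.

(** Reversing the index and negating [n] reflects the residue, which is why [j] is paired with
    [N - 1 - j] and not with [N - j]. *)
Lemma frac_part_wrap_opp (N n j : nat) :
  (n < N)%nat -> (j < N)%nat ->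
  frac_part ((INR (N - 1 - j) + IZR (- Z.of_nat n)) / INR N)
  = (INR (N - 1 - wrap N n j) / INR N)%R.
Proof.
intros Hn Hj; assert (HN : (0 < INR N)%R) by (apply lt_0_INR; lia).
assert (Hw : (0 <= INR (N - 1 - wrap N n j) / INR N < 1)%R).
{ split; [apply Rdiv_le_0_compat; [apply pos_INR | exact HN] |].
  apply Rlt_div_l; [exact HN |]; rewrite Rmult_1_l.
  apply lt_INR; lia. }
rewrite opp_IZR, <- INR_IZR_INZ.
revert Hw; unfold wrap.
destruct (Nat.ltb_spec (j + n) N) as [H | H]; intros Hw.
- etransitivity; [| exact (frac_part_add_Z _ 0 Hw)]; f_equal.
  rewrite !minus_INR, plus_INR by lia; field; lra.
- etransitivity; [| exact (frac_part_add_Z _ (- 1) Hw)]; f_equal.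
  rewrite !minus_INR, plus_INR by lia; field; lra.
Qed.

Lemma D_mult_opp (N : nat) (theta : C) (x : R) (n : nat) :
  (n < N)%nat -> Cmod theta = 1%R -> (0 < Re theta)%R -> (0 < Im theta)%R ->
  D N theta x (Z.of_nat n) * D N theta (- x) (- Z.of_nat n)
  = Cexp (Csum (fun j =>
      let z := D_arg N theta (x / sqrt (INR N))
                 (INR j / INR N) (INR (wrap N n j) / INR N) in
      PI * Ci * z * z + PI * Ci * (theta ^ 2 + / theta ^ 2) / 12) N).
Proof.
intros Hn Hmod HRe HIm.
assert (HN : (0 < INR N)%R) by (apply lt_0_INR; lia).
assert (HNC : RtoC (INR N) <> 0) by (apply INR_C_neq_0; lia).
pose proof (theta_neq_0 theta Hmod) as H0.
assert (HS : RtoC (sqrt (INR N)) <> 0).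
{ intros E; apply RtoC_inj in E; pose proof (sqrt_lt_R0 _ HN); lra. }
unfold D.
match goal with |- _ * Cprod ?g N = _ => rewrite <- (Cprod_rev g N) end.
rewrite <- Cprod_mult, <- Cprod_Cexp; apply Cprod_ext_lt; intros j Hj; cbv zeta.
rewrite frac_part_wrap, frac_part_wrap_opp by assumption.
assert (Hj1 : (INR j <= INR N - 1)%R).
{ assert (INR (S j) <= INR N)%R by (apply le_INR; lia).
  rewrite S_INR in *; lra. }
pose proof (wrap_lt N n j Hn Hj) as Hw.
set (m := wrap N n j) in *; clearbody m.
assert (Hm1 : (INR m <= INR N - 1)%R).
{ assert (INR (S m) <= INR N)%R by (apply le_INR; lia).
  rewrite S_INR in *; lra. }
set (z := D_arg N theta (x / sqrt (INR N)) (INR j / INR N) (INR m / INR N)).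
replace (_ / _ + _ * c_ theta - _ - _) with z.
2: { unfold z, D_arg; rewrite !RtoC_div by (try apply Rgt_not_eq, sqrt_lt_R0; lra).
     reflexivity. }
(* The reflections contribute [Ci * (theta + / theta)], that is [2 * c_ theta], times 1 - 1/N, which
   turns the constant term into its negative. *)
replace (_ / _ + _ * c_ theta - _ - _) with (- z).
2: { unfold z, D_arg, c_.
     rewrite !RtoC_div by (try apply Rgt_not_eq, sqrt_lt_R0; lra).
     rewrite !minus_INR, !RtoC_minus, RtoC_opp by lia.
     change (INR 1) with 1%R; field; auto. }
apply Phi_inversion; [assumption .. |].
unfold z; rewrite Im_D_arg by (assumption || lia).
pose proof (pos_INR j); pose proof (pos_INR m).
assert (Hiv : (0 < / INR N)%R) by now apply Rinv_0_lt_compat.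
assert (HNi : (INR N * / INR N = 1)%R) by (field; lra).
(* With both fractions in this range the height is at most [Re theta * (1 - / INR N)] in absolute
   value, strictly below [Re theta]. *)
assert (Q : forall y, (0 <= y <= INR N - 1 -> 0 <= y / INR N <= 1 - / INR N)%R).
{ intros y Hy; unfold Rdiv; nra. }
pose proof (Q (INR j)); pose proof (Q (INR m)).
apply Rabs_def1; nra.
Qed.

Theorem lemma5 (N : nat) (theta : C)
  (hN : (0 < N)%nat)
  (htheta : Cmod theta = 1%R)
  (hRe : (0 < Re theta)%R)
  (hIm : (0 < Im theta)%R)
  (x : R) (n : Z) :
  D N theta x n * D N theta (- x)%R (- n)%Z
  = bracket N x n
    * Cexp (- (PI * Ci * (INR N + 2 * c_ theta ^ 2 * / INR N) / 6)).
Proof.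
(* Periodicity of both sides reduces the claim to representatives from 0 to N - 1. *)
assert (Hd : n = (n mod Z.of_nat N + n / Z.of_nat N * Z.of_nat N)%Z)
  by (pose proof (Z_div_mod_eq_full n (Z.of_nat N)); lia).
assert (Hr : (0 <= n mod Z.of_nat N < Z.of_nat N)%Z)
  by (apply Z.mod_pos_bound; lia).
rewrite Hd; set (r := (n mod Z.of_nat N)%Z) in *.
set (k := (n / Z.of_nat N)%Z); clearbody r k; clear Hd n.
replace (- (r + k * Z.of_nat N))%Z with (- r + - k * Z.of_nat N)%Z by lia.
rewrite (periodic_Z _ (D N theta x)) by (intros; now apply D_period).
rewrite (periodic_Z _ (D N theta (- x))) by (intros; now apply D_period).
rewrite (periodic_Z _ (bracket N x)) by (intros; now apply bracket_period).
rewrite <- (Z2Nat.id r) by lia; set (n := Z.to_nat r).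
assert (Hn : (n < N)%nat) by (unfold n; lia); clearbody n; clear r k Hr.
rewrite D_mult_opp by assumption.
unfold bracket; rewrite <- !Cexp_plus.
pose proof (theta_neq_0 theta htheta) as H0.
pose proof (INR_C_neq_0 N hN) as HNC.
assert (HC : Ci * Ci = - (1)) by (apply injective_projections; simpl; ring).
(* The exponents of the two sides are not equal: they differ by 2 pi i n. *)
rewrite <- (Cexp_sub_2PI _ (Z.of_nat n)); f_equal.
rewrite <- INR_IZR_INZ.
set (t := (x / sqrt (INR N))%R).
assert (Hx : x * x = t * t * INR N).
{ rewrite <- !RtoC_mult; f_equal; unfold t.
  assert (HNR : (0 < INR N)%R) by now apply lt_0_INR.
  pose proof (sqrt_sqrt (INR N)) as E; pose proof (sqrt_lt_R0 _ HNR).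
  rewrite <- E at 3 by lra; field; lra. }
(* The index at which [j + n] passes [N]; the sum is split there because the summand is a polynomial
   in [j] on either side only. *)
set (M := (N - n)%nat).
assert (HN : N = (M + n)%nat) by (unfold M; lia).
assert (HNR : RtoC (INR N) = INR M + INR n) by (rewrite HN, plus_INR, RtoC_plus; reflexivity).
(* Arguments are written [t + Ci * w], and the term with [c_ theta] adds [d] to the coefficients of
   [theta] and [/ theta] in [w]. On either range [w] is affine in [j], with slope [w1] and initial
   value [w0] or [w0']. *)
set (d := (INR N - 1) / (2 * INR N)).
set (w1 := - (theta + / theta) / INR N).
set (w0 := theta * (d - INR n / INR N) + / theta * d).
set (w0' := theta * d + / theta * (d - INR M / INR N)).
set (s := theta ^ 2 + / theta ^ 2).
set (quad := fun w (j : nat) =>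
  PI * Ci * (t * t + 2 * Ci * t * w - w * w + s / 12)
  + PI * Ci * (2 * Ci * t * w1 - 2 * w * w1) * INR j
  + - (PI * Ci * w1 * w1) * INR j * INR j).
assert (HZ : forall (a b : R) (w : C),
  w = theta * (d - b) + / theta * (d - a) ->
  PI * Ci * D_arg N theta t a b * D_arg N theta t a b + PI * Ci * s / 12
  = PI * Ci * (t * t + 2 * Ci * t * w - w * w + s / 12)).
{ intros a b w Hw.
  replace (D_arg N theta t a b) with (t + Ci * w).
  - transitivity (PI * Ci * (t * t + 2 * Ci * t * w + (Ci * Ci) * w * w + s / 12));
      [field | rewrite HC; ring].
  - rewrite Hw; unfold D_arg, c_, d; field; auto. }
replace (Csum _ N) with (Csum (quad w0) M + Csum (quad w0') n).
- unfold quad; rewrite !Csum_quadratic.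
  assert (Hc : c_ theta ^ 2 = - (s + 2) / 4).
  { unfold c_, s; transitivity (Ci * Ci * ((theta + / theta) / 2) ^ 2);
      [field; exact H0 | rewrite HC; field; exact H0]. }
  rewrite Hc; replace (RtoC x ^ 2) with (x * x) by ring; rewrite Hx.
  unfold w0, w0', w1, d, s; rewrite HNR in *; field; auto.
- symmetry; match goal with |- Csum ?F N = _ =>
    transitivity (Csum F (M + n)); [now rewrite <- HN |] end.
  rewrite Csum_add; f_equal; apply Csum_ext; intros j Hj;
    cbv beta zeta; unfold wrap; fold s.
  + destruct (Nat.ltb_spec (j + n) N) as [H | H]; [| lia].
    rewrite (HZ _ _ (w0 + w1 * INR j)).
    * unfold quad; ring.
    * rewrite !RtoC_div by (apply not_0_INR; lia).
      rewrite plus_INR, RtoC_plus; unfold w0, w1; field; auto.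
  + destruct (Nat.ltb_spec (M + j + n) N) as [H | H]; [lia |].
    replace (M + j + n - N)%nat with j by lia.
    rewrite (HZ _ _ (w0' + w1 * INR j)).
    * unfold quad; ring.
    * rewrite !RtoC_div by (apply not_0_INR; lia).
      rewrite plus_INR, RtoC_plus; unfold w0', w1; field; auto.
Qed.
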